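(* Let $\mathcal{A}_0=\mathcal{C}_0\cup\mathcal{C}_1$ be a generic realization of $M_7$, where $\mathcal{C}_0=(\ell_1,\dots,\ell_7)$ and $\mathcal{C}_1=(\ell'_1,\dots,\ell'_7)$, and define the labeled arrangement $\mathcal{C}_2=(\ell''_1,\dots,\ell''_7)$ by $\ell''_j=\Lambda_{\{2\},\{3\}}\big(\sum_{k\neq j}\ell'_k\big)$. Then each $\ell''_j$ is a single line and $\mathcal{A}_1=\mathcal{C}_1\cup\mathcal{C}_2$ (with $\ell'_i$ labeled $i$ and $\ell''_i$ labeled $i'$) is again a realization of $M_7$. Consequently the operator $\Lambda_{\{2\},\{3\}}$ induces a rational self-map of the scheme $\mathfrak{U}_7$ of all realizations of $M_7$ and a (dominant) rational self-map of its moduli space $\mathcal{R}_7$, namely $[\mathcal{C}_0\cup\mathcal{C}_1]\mapsto[\mathcal{C}_1\cup\mathcal{C}_2]$.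
   Context: Over $\mathbb{C}$. In a line arrangement, a double point is a point where exactly two lines meet. For a line arrangement $\mathcal{C}$, $\Lambda_{\{2\},\{3\}}(\mathcal{C})$ is the union of all lines of $\mathbb{P}^2$ containing exactly three double points of $\mathcal{C}$. $M_7$ is the rank-3 matroid on $\{1,\dots,7,1',\dots,7'\}$ in which every 3-subset is a basis except the triples $\{a,b,c'\}$ with $a\neq b\in\{1,\dots,7\}$, $c\in\{1,\dots,7\}$, $a+b\equiv 2c\pmod 7$. A realization is a labeled family of 14 distinct lines in $\mathbb{P}^2$ such that three of them are concurrent iff their labels form a non-basis. $\mathfrak{U}_7$ is the scheme of realizations and $\mathcal{R}_7$ the moduli space of $\mathrm{PGL}_3$-orbits $[\mathcal{A}]$ of realizations (a surface). *)

(* Defs.v *)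
From mathcomp Require Import all_boot all_algebra.
From mathcomp Require Import reals.
From mathcomp Require Import complex.
Set Implicit Arguments. Unset Strict Implicit. Unset Printing Implicit Defensive.
Import GRing.Theory Num.Theory.
Local Open Scope ring_scope.

(* Lines and points of P^2(C) are represented by nonzero row vectors of C^3,
   up to nonzero scaling.  Point p lies on line l iff p . l = 0. *)

Section Geometry.
Variable C : fieldType.

Definition on_line (p l : 'rV[C]_3) : bool := (p *m l^T) 0 0 == 0.

Definition same_pt (u v : 'rV[C]_3) : Prop := exists c : C, c != 0 /\ v = c *: u.

(* 3x3 matrix with rows u, v, w; three lines are concurrent iff its det is 0 *)
Definition tri (u v w : 'rV[C]_3) : 'M[C]_3 :=
  \matrix_(i < 3, j < 3)
     (if (val i == 0)%N then u 0 j else if (val i == 1)%N then v 0 j else w 0 j).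

(* A line arrangement given as a family F indexed by the elements of S. *)
Definition mult_pt (I : finType) (F : I -> 'rV[C]_3) (S : {set I}) (p : 'rV[C]_3) : nat :=
  #|[set k in S | on_line p (F k)]|.

Definition dpoint (I : finType) (F : I -> 'rV[C]_3) (S : {set I}) (p : 'rV[C]_3) : Prop :=
  p != 0 /\ mult_pt F S p = 2%N.

Definition three_dp (I : finType) (F : I -> 'rV[C]_3) (S : {set I}) (v : 'rV[C]_3) : Prop :=
  v != 0 /\
  exists p1 p2 p3 : 'rV[C]_3,
    [/\ (dpoint F S p1 /\ on_line p1 v), (dpoint F S p2 /\ on_line p2 v), (dpoint F S p3 /\ on_line p3 v),
         (~ same_pt p1 p2 /\ ~ same_pt p1 p3) & ~ same_pt p2 p3] /\
    (forall p, dpoint F S p -> on_line p v -> [\/ same_pt p1 p, same_pt p2 p | same_pt p3 p]).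

Definition Lambda23 (I : finType) (F : I -> 'rV[C]_3) (S : {set I}) (p : 'rV[C]_3) : Prop :=
  exists v, three_dp F S v /\ on_line p v.

(* labels of M_7: inl i is the label i+1, inr i is the label (i+1)' *)
Definition lab := ('I_7 + 'I_7)%type.

Definition arr := lab -> 'rV[C]_3.

(* non-bases of M_7 (for pairwise distinct labels): {a, b, c'} with a != b and
   a + b = 2c mod 7 (shifting labels by one does not affect this condition) *)
Definition nb_cond (a b c : 'I_7) : bool :=
  (a != b) && ((a + b) %% 7 == (2 * c) %% 7)%N.

Definition nonbasis (x y z : lab) : bool :=
  match x, y, z with
  | inl a, inl b, inr c => nb_cond a b c
  | inl a, inr c, inl b => nb_cond a b c
  | inr c, inl a, inl b => nb_cond a b c
  | _, _, _ => false
  end.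

Definition realization (A : arr) : Prop :=
  [/\ forall x, A x != 0,
      forall x y, x != y -> \rank (col_mx (A x) (A y)) = 2%N
    & forall x y z, x != y -> y != z -> x != z ->
        (\det (tri (A x) (A y) (A z)) == 0) = nonbasis x y z].

Inductive polyfun : (arr -> C) -> Prop :=
  | pf_cst (c : C) : polyfun (fun _ => c)
  | pf_coord (x : lab) (j : 'I_3) : polyfun (fun A => A x 0 j)
  | pf_add f g : polyfun f -> polyfun g -> polyfun (fun A => f A + g A)
  | pf_mul f g : polyfun f -> polyfun g -> polyfun (fun A => f A * g A).

(* the Zariski-open set {P <> 0} meets the realization space U_7 in a
   Zariski-dense subset of U_7 *)
Definition dense_open_in_U (P : arr -> C) : Prop :=
  forall Q, polyfun Q ->
    (forall A, realization A -> P A != 0 -> Q A = 0) ->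
    forall A, realization A -> Q A = 0.

Definition next_arr (A : arr) (m : 'I_7 -> 'rV[C]_3) : arr :=
  fun x => match x with inl i => A (inr i) | inr i => m i end.

Definition Cprime (A : arr) : 'I_7 -> 'rV[C]_3 := fun k => A (inr k).
Definition others (j : 'I_7) : {set 'I_7} := [set k | k != j].

(* action of GL_3 together with independent rescaling of each line vector
   (i.e. the PGL_3 action on (P^2)^14 lifted to representatives) *)
Definition arr_act (g : 'M[C]_3) (s : lab -> C) (A : arr) : arr :=
  fun x => s x *: (A x *m g).

End Geometry.

(* Main.v *)
From Stdlib Require Import ZArith FunctionalExtensionality.
Require Import Defs.
From HB Require Import structures.
From mathcomp Require Import all_boot all_algebra.
From mathcomp Require Import reals.
From mathcomp Require Import complex.
From mathcomp Require Import ring zify ssrZ.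
Import GRing.Theory Num.Theory.
Set Implicit Arguments. Unset Strict Implicit. Unset Printing Implicit Defensive.
Local Open Scope ring_scope.

(* Dually a realization is fourteen points p_a, q_c with q_c on the line p_a p_b
   iff a + b = 2c; they lie on a cubic, as p_a = x + a t and q_c = -2x - 2c t
   with t of order 7, and the operator is multiplication by -2.  The proof avoids
   the cubic.  Sending p_0, ..., p_3 to the standard frame identifies the moduli
   space with an open part of a surface [surf u v w = 0], quadratic in v, whose
   discriminant is not a square in C(u, w); hence a polynomial vanishing on a
   nonempty open part of the surface vanishes on it.  The three lines defining
   l''_j concur because a determinant is a multiple of [surf].  Every genericity
   condition, including the Jacobian of the induced self-map, is checked at the
   integral point (8, -2, -7).  Dominance then follows: a polynomial n(u, w)
   vanishing on the image has, by the chain rule along the tangent fields of the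
   surface, partial derivatives that vanish there too, so n = 0 by induction on
   the degree. *)

(** * Vectors and brackets *)

(** Irreducibility and dimension enter only through statements about vanishing polynomials. The
    surface is a double cover of the (u, w)-plane: a function on it reduces to a + b v, and its norm
    is a polynomial in u and w. This norm vanishes only for a = b = 0, because the discriminant is w
    times a polynomial that is nonzero at w = 0. That fact stands in for irreducibility twice. A
    nonempty open set contains both points over a general (u, w), which forces a + b v to be zero
    once it vanishes there; and dominance need only be proved for the coordinates (u, w) of the
    image. A realization carries besides (u, v, w) a projective frame and fourteen scalars; these
    are frozen while (u, v, w) moves on the surface. The genericity conditions involve far too many
    determinants to expand: they are evaluated over Z at one point, and their nonvanishing is
    carried to C by the ring morphism from Z. *)

Notation i0 := (@Ordinal 3 0 isT).
Notation i1 := (@Ordinal 3 1 isT).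
Notation i2 := (@Ordinal 3 2 isT).

Section Vectors.
Variable R : comNzRingType.
Implicit Types (x y z t : 'rV[R]_3) (a : R).

Definition vec (t : R * R * R) : 'rV[R]_3 :=
  \row_(j < 3) nth 0 [:: t.1.1; t.1.2; t.2] j.

Lemma ord3P (P : 'I_3 -> Prop) : P i0 -> P i1 -> P i2 -> forall j, P j.
Proof.
by move=> h0 h1 h2 [[|[|[|//]]] lt_j];
  [move: h0 | move: h1 | move: h2]; congr P; apply/val_inj.
Qed.

Lemma row3P x y : x 0 i0 = y 0 i0 -> x 0 i1 = y 0 i1 -> x 0 i2 = y 0 i2 -> x = y.
Proof. by move=> h0 h1 h2; apply/rowP; apply: ord3P. Qed.

Lemma vecE (t : R * R * R) :
  (vec t 0 i0 = t.1.1) * (vec t 0 i1 = t.1.2) * (vec t 0 i2 = t.2).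
Proof. by rewrite /vec !mxE. Qed.

Lemma sum3E (F : 'I_3 -> R) : \sum_j F j = F i0 + F i1 + F i2.
Proof.
rewrite !big_ord_recl big_ord0 addr0 addrA.
by congr (F _ + F _ + F _); apply/val_inj.
Qed.

Definition dot x y : R := x 0 i0 * y 0 i0 + x 0 i1 * y 0 i1 + x 0 i2 * y 0 i2.

Definition cross x y : 'rV[R]_3 :=
  vec (x 0 i1 * y 0 i2 - x 0 i2 * y 0 i1,
       x 0 i2 * y 0 i0 - x 0 i0 * y 0 i2,
       x 0 i0 * y 0 i1 - x 0 i1 * y 0 i0).

Definition br x y z : R :=
  x 0 i0 * (y 0 i1 * z 0 i2 - y 0 i2 * z 0 i1)
  + x 0 i1 * (y 0 i2 * z 0 i0 - y 0 i0 * z 0 i2)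
  + x 0 i2 * (y 0 i0 * z 0 i1 - y 0 i1 * z 0 i0).

(* The line joining the points x /\ y and z /\ t, where /\ is the meet of two
   lines: (x * y) * (z * t) for the cross product. *)
Definition join4 x y z t : 'rV[R]_3 := br x y t *: z - br x y z *: t.

Definition coordE := (mxE, vecE).

Lemma det2 (B : 'M[R]_2) : \det B = B 0 0 * B 1 1 - B 0 1 * B 1 0.
Proof.
rewrite (expand_det_row _ 0) !big_ord_recl big_ord0 /cofactor !det_mx11 !mxE.
have -> : lift 0 0 = 1 :> 'I_2 by apply/val_inj.
have -> : lift 1 0 = 0 :> 'I_2 by apply/val_inj.
by rewrite /= expr0 expr1; ring.
Qed.

Lemma det3 (B : 'M[R]_3) :
  \det B = B i0 i0 * (B i1 i1 * B i2 i2 - B i1 i2 * B i2 i1)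
         + B i0 i1 * (B i1 i2 * B i2 i0 - B i1 i0 * B i2 i2)
         + B i0 i2 * (B i1 i0 * B i2 i1 - B i1 i1 * B i2 i0).
Proof.
rewrite (expand_det_row _ i0) sum3E /cofactor !det2 !mxE.
have -> : lift i0 0 = i1 :> 'I_3 by apply/val_inj.
have -> : lift i0 1 = i2 :> 'I_3 by apply/val_inj.
have -> : lift i1 0 = i0 :> 'I_3 by apply/val_inj.
have -> : lift i1 1 = i2 :> 'I_3 by apply/val_inj.
have -> : lift i2 0 = i0 :> 'I_3 by apply/val_inj.
have -> : lift i2 1 = i1 :> 'I_3 by apply/val_inj.
by rewrite /= !exprS expr0; ring.
Qed.

End Vectors.

Section VectorTheory.
Variable C : fieldType.
Implicit Types (x y z t l : 'rV[C]_3) (a : C) (g : 'M[C]_3).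

Lemma det_triE x y z : \det (tri x y z) = br x y z.
Proof. by rewrite det3 !mxE. Qed.

Lemma on_lineE x l : on_line x l = (dot x l == 0).
Proof. by rewrite /on_line !mxE sum3E !mxE. Qed.

Lemma dotC x y : dot x y = dot y x.
Proof. by rewrite /dot; ring. Qed.

Lemma tri_mul x y z g : tri (x *m g) (y *m g) (z *m g) = tri x y z *m g.
Proof.
apply/matrixP => i j; rewrite !mxE.
by case: ifP => e0; [|case: ifP => e1]; rewrite ?mxE; apply: eq_bigr => k _;
  rewrite !mxE e0 ?e1.
Qed.

Lemma br_mul x y z g : br (x *m g) (y *m g) (z *m g) = br x y z * \det g.
Proof. by rewrite -!det_triE tri_mul det_mulmx. Qed.

Lemma br_scale a b c x y z :
  br (a *: x) (b *: y) (c *: z) = a * b * c * br x y z.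
Proof. by rewrite /br !mxE; ring. Qed.

Lemma br_act (a b c : C) g x y z :
  br (a *: (x *m g)) (b *: (y *m g)) (c *: (z *m g)) = a * b * c * \det g * br x y z.
Proof. by rewrite br_scale br_mul; ring. Qed.

Lemma join4_act (a b c d : C) g x y z t :
  join4 (a *: (x *m g)) (b *: (y *m g)) (c *: (z *m g)) (d *: (t *m g))
  = (a * b * c * d * \det g) *: (join4 x y z t *m g).
Proof.
rewrite /join4 !br_act mulmxBl -!scalemxAl scalerBr !scalerA.
by congr (_ *: _ - _ *: _); ring.
Qed.

Lemma brC1 x y z : br y x z = - br x y z.
Proof. by rewrite /br; ring. Qed.

Lemma brC2 x y z : br x z y = - br x y z.
Proof. by rewrite /br; ring. Qed.

Lemma br_cross x y z : br x y z = dot (cross x y) z.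
Proof. by rewrite /br /dot !coordE /=; ring. Qed.

Lemma dot_cross1 x y : dot (cross x y) x = 0.
Proof. by rewrite /dot !coordE /=; ring. Qed.

Lemma dot_cross2 x y : dot (cross x y) y = 0.
Proof. by rewrite /dot !coordE /=; ring. Qed.

Lemma cross_cross x y z t : cross (cross x y) (cross z t) = join4 x y z t.
Proof.
by apply/row3P; rewrite /join4 /br !coordE /=; ring.
Qed.

(** Three meets of pairs of lines are collinear exactly when the line joining two of them is
    concurrent with the third pair; the genericity conditions are stated in this second form. *)
Lemma br_meet x y z t u v :
  br (cross x y) (cross z t) (cross u v) = br (join4 x y z t) u v.
Proof.
have brE (a b c : 'rV[C]_3) : br a b c = dot a (cross b c) by rewrite /br /dot !coordE.
by rewrite br_cross cross_cross brE.
Qed.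

Lemma cross_eq0 x y : x != 0 -> cross x y = 0 -> exists a, y = a *: x.
Proof.
move=> x0 /rowP xy0.
have := xy0 i0; have := xy0 i1; have := xy0 i2; rewrite !coordE /=.
move=> /subr0_eq e2 /subr0_eq e1 /subr0_eq e0.
have [j xj] : exists j, x 0 j != 0.
  by apply/existsP; apply: contra_neqT x0 => /existsPn h; apply/rowP => j;
    have := h j; rewrite negbK mxE => /eqP.
exists (y 0 j / x 0 j); move: j xj.
apply: ord3P => xj; apply/row3P; rewrite !mxE; apply: (mulfI xj);
  rewrite [RHS]mulrA [x _ _ * (_ / _)]mulrC divfK // [RHS]mulrC.
all: by rewrite ?e0 ?e1 ?e2.
Qed.

Lemma same_ptP x y : x != 0 -> y != 0 -> (same_pt x y <-> cross x y = 0).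
Proof.
move=> x0 y0; split=> [[c [c0 ->]]|h].
  by apply/row3P; rewrite !coordE /=; ring.
have [a e] := cross_eq0 x0 h; exists a; split => //.
by apply: contra_neq y0 => a0; rewrite e a0 scale0r.
Qed.

Lemma dot_cross_span x y l : cross x y != 0 -> dot x l = 0 -> dot y l = 0 ->
  exists a, l = a *: cross x y.
Proof.
move=> xy0 xl yl; apply: cross_eq0 => //; apply/row3P; rewrite !coordE /=.
(* Coordinatewise, (x × y) × l = (x . l) y - (y . l) x. *)
- transitivity (y 0 i0 * dot x l - x 0 i0 * dot y l); first by rewrite /dot; ring.
  by rewrite xl yl; ring.
- transitivity (y 0 i1 * dot x l - x 0 i1 * dot y l); first by rewrite /dot; ring.
  by rewrite xl yl; ring.
- transitivity (y 0 i2 * dot x l - x 0 i2 * dot y l); first by rewrite /dot; ring.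
  by rewrite xl yl; ring.
Qed.

Lemma same_pt_sym x y : same_pt x y -> same_pt y x.
Proof.
move=> [c [c0 ->]]; exists c^-1; split; first by rewrite invr_eq0.
by rewrite scalerA mulVf // scale1r.
Qed.

Lemma same_pt_on x y l : same_pt x y -> on_line x l -> on_line y l.
Proof.
move=> [c [c0 ->]]; rewrite !on_lineE /dot !mxE => /eqP h; apply/eqP.
transitivity (c * dot x l); last by rewrite /dot h mulr0.
by rewrite /dot; ring.
Qed.

Lemma same_line_on x l m : same_pt l m -> on_line x l = on_line x m.
Proof.
have onC (a b : 'rV[C]_3) : on_line a b = on_line b a by rewrite !on_lineE dotC.
move=> lm; rewrite !(onC x); apply/idP/idP; apply: same_pt_on => //.
exact: same_pt_sym.
Qed.

Lemma two_points_line x y l m : x != 0 -> y != 0 -> l != 0 -> m != 0 ->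
  ~ same_pt x y -> on_line x l -> on_line y l -> on_line x m -> on_line y m ->
  same_pt l m.
Proof.
move=> x0 y0 l0 m0 xy; rewrite !on_lineE => /eqP xl /eqP yl /eqP xm /eqP ym.
have c0 : cross x y != 0 by apply/eqP => h; apply/xy/same_ptP.
have [a el] := dot_cross_span c0 xl yl; have [b em] := dot_cross_span c0 xm ym.
have a0 : a != 0 by apply: contra_neq l0 => a0; rewrite el a0 scale0r.
have b0 : b != 0 by apply: contra_neq m0 => b0; rewrite em b0 scale0r.
exists (b / a); split; first by rewrite mulf_neq0 ?invr_eq0.
by rewrite el em scalerA divfK.
Qed.

Lemma concurrent_br p x y z : p != 0 -> on_line p x -> on_line p y -> on_line p z ->
  br x y z = 0.
Proof.
move=> p0; rewrite !on_lineE => /eqP px /eqP py /eqP pz.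
have [e|xy0] := eqVneq (cross x y) 0.
  by rewrite br_cross e /dot !mxE; ring.
have [a e] : exists a, p = a *: cross x y.
  by apply: dot_cross_span => //; rewrite dotC.
have a0 : a != 0 by apply: contra_neq p0 => a0; rewrite e a0 scale0r.
apply: (mulfI a0); rewrite mulr0 -pz e br_cross /dot !mxE; ring.
Qed.

End VectorTheory.

(** * Six lines and their double points *)

Lemma fresh_in (I : finType) (S : {set I}) (s : seq I) :
  (size s < #|S|)%N -> exists2 k, k \in S & k \notin s.
Proof.
move=> lt_sS; apply/exists_inP; apply: contraLR lt_sS.
rewrite negb_exists_in -leqNgt => /forall_inP h.
apply: leq_trans (card_size s); apply/subset_leq_card/subsetP => k /h.
by rewrite negbK.
Qed.

Section SixLines.
Variables (C : fieldType) (I : finType) (F : I -> 'rV[C]_3) (S : {set I}).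
Variables (sg : I -> I) (m : 'rV[C]_3).
Hypothesis S6 : #|S| = 6%N.
Hypothesis F0 : forall i, i \in S -> F i != 0.
Hypothesis nconc : forall i j k, i \in S -> j \in S -> k \in S ->
  uniq [:: i; j; k] -> br (F i) (F j) (F k) != 0.
Hypothesis sgS : forall i, i \in S -> sg i \in S.
Hypothesis sg_neq : forall i, i \in S -> sg i != i.
Hypothesis sgK : forall i, sg (sg i) = i.
Hypothesis m0 : m != 0.
Hypothesis m_on : forall i, i \in S -> on_line (cross (F i) (F (sg i))) m.
Hypothesis generic : forall a b c d e f, all [in S] [:: a; b; c; d; e; f] ->
  uniq [:: a; b; c; d; e; f] ->
  br (join4 (F a) (F b) (F c) (F d)) (F e) (F f) = 0 -> b = sg a /\ d = sg c.

Let dp i j := cross (F i) (F j).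

Lemma meet_neq0 i j : i \in S -> j \in S -> i != j -> dp i j != 0.
Proof.
move=> iS jS ij; have [|k kS] := @fresh_in _ S [:: i; j]; first by rewrite S6.
rewrite !inE negb_or => /andP[ki kj].
have := nconc iS jS kS; rewrite /= !inE negb_or ij !(eq_sym _ k) ki kj => /(_ isT).
by apply: contra_neq => e; rewrite br_cross -/(dp i j) e /dot !mxE !mul0r !addr0.
Qed.

Lemma meet_unique i j p : i \in S -> j \in S -> i != j -> p != 0 ->
  on_line p (F i) -> on_line p (F j) -> same_pt (dp i j) p.
Proof.
rewrite !on_lineE => iS jS ij p0 /eqP pi /eqP pj.
have [||a e] := @dot_cross_span _ (F i) (F j) p (meet_neq0 iS jS ij); rewrite 1?dotC //.
by exists a; split => //; apply: contra_neq p0 => a0; rewrite e a0 scale0r.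
Qed.

Lemma no_triple i j k p : i \in S -> j \in S -> k \in S -> uniq [:: i; j; k] ->
  p != 0 -> on_line p (F i) -> on_line p (F j) -> ~~ on_line p (F k).
Proof.
move=> iS jS kS u p0 pi pj; apply/negP => pk.
by have /eqP := nconc iS jS kS u; apply; apply: concurrent_br pi pj pk.
Qed.

Lemma meet_on1 i j : on_line (dp i j) (F i).
Proof. by rewrite on_lineE dot_cross1. Qed.

Lemma meet_on2 i j : on_line (dp i j) (F j).
Proof. by rewrite on_lineE dot_cross2. Qed.

Lemma dpoint_meet i j : i \in S -> j \in S -> i != j -> dpoint F S (dp i j).
Proof.
move=> iS jS ij; have d0 := meet_neq0 iS jS ij; split => //.
transitivity #|[set i; j]|; last by rewrite cards2 ij.
apply: eq_card => k; rewrite !inE; apply/andP/orP => [[kS dk]|[]/eqP->].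
- apply/orP; apply: contraLR dk; rewrite negb_or => /andP[ki kj].
  apply: (no_triple iS jS kS _ d0); rewrite ?meet_on1 ?meet_on2 //.
  by rewrite /= !inE negb_or ij !(eq_sym _ k) ki kj.
- by rewrite meet_on1.
- by rewrite meet_on2.
Qed.

Lemma dpointP p : dpoint F S p -> exists i j,
  [/\ [/\ i \in S, j \in S & i != j], p != 0, on_line p (F i), on_line p (F j)
    & forall k, k \in S -> on_line p (F k) -> k = i \/ k = j].
Proof.
move=> [p0 /eqP/cards2P[i [j [ij e]]]]; exists i, j.
have /setP h := e; have := h i; have := h j; rewrite !inE !eqxx orbT /=.
move=> /andP[jS pj] /andP[iS pi]; split => // k kS pk.
by have := h k; rewrite !inE kS pk => /esym/orP[]/eqP->; [left|right].
Qed.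

(* A line [F i] carries five double points, so [v] meets it in at most one. *)
Lemma three_dp_not_line v p1 p2 p3 i :
  v != 0 -> i \in S -> dpoint F S p1 -> dpoint F S p2 -> dpoint F S p3 ->
  on_line p1 v -> on_line p2 v -> ~ same_pt p1 p2 ->
  (forall p, dpoint F S p -> on_line p v ->
     [\/ same_pt p1 p, same_pt p2 p | same_pt p3 p]) ->
  on_line p1 (F i) -> on_line p2 (F i) -> False.
Proof.
move=> v0 iS d1 d2 d3 p1v p2v p12 all3 p1i p2i.
have vi : same_pt (F i) v.
  by apply: (two_points_line d1.1 d2.1) => //; apply: F0.
(* A double point on [F i] lies on just one further line, [F b]. *)
have other p : dpoint F S p -> exists b, forall k, k \in S -> k != i -> k != b ->
    on_line p (F i) -> ~~ on_line p (F k).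
  move=> /dpointP[a [b [_ _ _ _ h]]]; have [ei|ni] := eqVneq i a.
    exists b => k kS ki kb _; apply/negP => /(h k kS)[] e; move: ki kb;
      by rewrite e ?ei eqxx.
  exists a => k kS ki ka pi; apply/negP => /(h k kS)[] e; first by rewrite e eqxx in ka.
  by have [e'|e'] := h i iS pi; move: ni ki; rewrite e ?e' eqxx.
have [[b1 h1] [b2 h2] [b3 h3]] := And3 (other _ d1) (other _ d2) (other _ d3).
(* Four excluded indices out of six leave a line [F k] whose meet with [F i] is a fourth double
   point on [v]. *)
have [|k kS] := @fresh_in _ S [:: i; b1; b2; b3]; first by rewrite S6.
rewrite !inE !negb_or => /and4P[ki k1 k2 k3].
have dv : on_line (dp i k) v by rewrite -(same_line_on _ vi) meet_on1.
have dk : dpoint F S (dp i k) by apply: dpoint_meet; rewrite // eq_sym.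
have [] := all3 _ dk dv => /same_pt_sym s;
  have := same_pt_on s (meet_on1 i k); have := same_pt_on s (meet_on2 i k) => onk oni.
- by have := h1 k kS ki k1 oni; rewrite onk.
- by have := h2 k kS ki k2 oni; rewrite onk.
- by have := h3 k kS ki k3 oni; rewrite onk.
Qed.

(** By [three_dp_not_line] no two of the three double points share a line of the arrangement, so
    they use six distinct lines and [generic] applies. Matching two of the pairs is enough, as two
    points determine the line. *)
Lemma three_dp_same v : three_dp F S v -> same_pt v m.
Proof.
move=> [v0 [p1 [p2 [p3 [[[d1 p1v] [d2 p2v] [d3 p3v] [p12 p13] p23] all3]]]]].
have disj p q p' i : dpoint F S p -> dpoint F S q -> dpoint F S p' ->
    on_line p v -> on_line q v -> ~ same_pt p q ->
    (forall x, dpoint F S x -> on_line x v ->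
       [\/ same_pt p x, same_pt q x | same_pt p' x]) ->
    i \in S -> on_line p (F i) -> on_line q (F i) -> False.
  by move=> dp_ dq dp' pv qv pq h iS; apply: three_dp_not_line h.
have all31 x : dpoint F S x -> on_line x v ->
    [\/ same_pt p1 x, same_pt p3 x | same_pt p2 x].
  by move=> dx xv; have [] := all3 x dx xv; [constructor 1|constructor 3|constructor 2].
have all32 x : dpoint F S x -> on_line x v ->
    [\/ same_pt p2 x, same_pt p3 x | same_pt p1 x].
  by move=> dx xv; have [] := all3 x dx xv; [constructor 3|constructor 1|constructor 2].
have [a [a' [[aS a'S aa'] _ p1a p1a' _]]] := dpointP d1.
have [b [b' [[bS b'S bb'] _ p2b p2b' _]]] := dpointP d2.
have [c [c' [[cS c'S cc'] _ p3c p3c' _]]] := dpointP d3.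
have n12 i j : i \in S -> on_line p1 (F i) -> on_line p2 (F j) -> i != j.
  by move=> iS p1i p2j; apply/eqP => e; subst j; apply: (disj p1 p2 p3 i).
have n13 i j : i \in S -> on_line p1 (F i) -> on_line p3 (F j) -> i != j.
  by move=> iS p1i p3j; apply/eqP => e; subst j; apply: (disj p1 p3 p2 i).
have n23 i j : i \in S -> on_line p2 (F i) -> on_line p3 (F j) -> i != j.
  by move=> iS p2i p3j; apply/eqP => e; subst j; apply: (disj p2 p3 p1 i).
have s1 := meet_unique aS a'S aa' d1.1 p1a p1a'.
have s2 := meet_unique bS b'S bb' d2.1 p2b p2b'.
have s3 := meet_unique cS c'S cc' d3.1 p3c p3c'.
have on1 := same_pt_on (same_pt_sym s1) p1v.
have on2 := same_pt_on (same_pt_sym s2) p2v.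
have on3 := same_pt_on (same_pt_sym s3) p3v.
have [ea eb] : a' = sg a /\ b' = sg b.
  apply: (@generic a a' b b' c c'); rewrite /= ?aS ?a'S ?bS ?b'S ?cS ?c'S //.
    rewrite !inE !negb_or aa' bb' cc' (n12 _ _ aS p1a p2b)
      (n12 _ _ aS p1a p2b') (n13 _ _ aS p1a p3c) (n13 _ _ aS p1a p3c')
      (n12 _ _ a'S p1a' p2b) (n12 _ _ a'S p1a' p2b') (n13 _ _ a'S p1a' p3c)
      (n13 _ _ a'S p1a' p3c') (n23 _ _ bS p2b p3c) (n23 _ _ bS p2b p3c')
      (n23 _ _ b'S p2b' p3c) (n23 _ _ b'S p2b' p3c') //.
  rewrite -br_meet; apply: (concurrent_br v0);
    by move: on1 on2 on3; rewrite !on_lineE !(dotC v).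
have mp1 : on_line p1 m by apply: same_pt_on s1 _; rewrite ea; apply: m_on.
have mp2 : on_line p2 m by apply: same_pt_on s2 _; rewrite eb; apply: m_on.
exact: (two_points_line d1.1 d2.1).
Qed.

(** The three double points are the meets of the three pairs [{i, sg i}] that partition [S]. *)
Lemma three_dp_m : three_dp F S m.
Proof.
have [|a aS _] := @fresh_in _ S [::]; first by rewrite S6.
have [|b bS] := @fresh_in _ S [:: a; sg a]; first by rewrite S6.
rewrite !inE negb_or => /andP[ba bsa].
have [|c cS] := @fresh_in _ S [:: a; sg a; b; sg b]; first by rewrite S6.
rewrite !inE !negb_or => /and4P[ca csa cb csb].
have sgI := can_inj sgK.
have par i j : i \in S -> j \in S -> j != i -> j != sg i ->
    ~ same_pt (dp i (sg i)) (dp j (sg j)).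
  move=> iS jS ji jsi s.
  have := same_pt_on (same_pt_sym s) (meet_on1 j (sg j)); apply/negP.
  apply: (@no_triple i (sg i) j); rewrite ?meet_on1 ?meet_on2 ?sgS //.
    by rewrite /= !inE !negb_or !(eq_sym _ j) ji jsi eq_sym sg_neq.
  by apply: meet_neq0; rewrite ?sgS // eq_sym sg_neq.
have dpS i : i \in S -> dpoint F S (dp i (sg i)).
  by move=> iS; apply: dpoint_meet; rewrite ?sgS // eq_sym sg_neq.
split => //; exists (dp a (sg a)), (dp b (sg b)), (dp c (sg c)); split.
  split; [by split; [apply: dpS|apply: m_on]|by split; [apply: dpS|apply: m_on]
         |by split; [apply: dpS|apply: m_on]|by split; apply: par|exact: par].
move=> p dp_ pm; have [i [j [[iS jS ij] p0 pi pj _]]] := dpointP dp_.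
(* If unmatched lines [F i], [F j] met on [m], then [m] would contain two points of [F i] and equal
   it; the meet of [F j] and [F (sg j)], which is on [m], would then be a triple point. *)
have [ej|nj] := eqVneq j (sg i); last first.
  have ji : j != i by rewrite eq_sym.
  have pij : ~ same_pt p (dp i (sg i)).
    move=> s; have := same_pt_on s pj; apply/negP.
    apply: (@no_triple i (sg i) j); rewrite ?meet_on1 ?meet_on2 ?sgS //.
      by rewrite /= !inE !negb_or !(eq_sym _ j) ji nj eq_sym sg_neq.
    by apply: meet_neq0; rewrite ?sgS // eq_sym sg_neq.
  have mi : same_pt m (F i).
    apply: (two_points_line p0 (dpS i iS).1 m0 (F0 iS) pij) => //; first exact: m_on.
    exact: meet_on1.
  have := m_on jS; rewrite (same_line_on _ mi) => h; exfalso; move: h; apply/negP.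
  apply: (@no_triple j (sg j) i); rewrite ?meet_on1 ?meet_on2 ?sgS //.
    rewrite /= !inE !negb_or ji eq_sym sg_neq //=.
    by rewrite andbT; apply: contra_neq nj => e; rewrite -e sgK.
  by apply: meet_neq0; rewrite ?sgS // eq_sym sg_neq.
(* The three pairs already fill the six elements of [S], so [i] repeats one of them. *)
have [k [kl s]] : exists k, k \in [:: a; b; c] /\ (i = k \/ i = sg k).
  have : ~~ (uniq [:: i; a; sg a; b; sg b; c; sg c]).
    apply/negP => u; have := card_size [:: i; a; sg a; b; sg b; c; sg c].
    rewrite (card_uniqP u) /= => _.
    have : [set x in [:: i; a; sg a; b; sg b; c; sg c]] \subset S.
      by apply/subsetP => x; rewrite !inE; do 6?[case/orP]; move=> /eqP->; rewrite ?sgS.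
    by move=> /subset_leq_card; rewrite cardsE (card_uniqP u) S6.
  have u6 : uniq [:: a; sg a; b; sg b; c; sg c].
    rewrite /= !inE !negb_or (eq_sym a) sg_neq // (eq_sym a) ba (eq_sym a c) ca.
    rewrite (eq_sym (sg a) b) bsa (eq_sym (sg a) c) csa (eq_sym b (sg b)) sg_neq //.
    rewrite (eq_sym b c) cb (eq_sym (sg b) c) csb (eq_sym c) sg_neq // !(inj_eq sgI).
    rewrite (eq_sym a b) ba (eq_sym a c) ca (eq_sym b c) cb.
    rewrite -(inj_eq sgI a) sgK (eq_sym (sg a)) bsa.
    rewrite -(inj_eq sgI a) sgK (eq_sym (sg a)) csa.
    by rewrite -(inj_eq sgI b) sgK (eq_sym (sg b)) csb.
  rewrite cons_uniq u6 andbT negbK !inE.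
  do 6?[case/orP]; move=> /eqP->; [exists a|exists a|exists b|exists b|exists c|exists c];
    by rewrite !inE eqxx ?orbT; split; auto.
have kS : k \in S by move: kl; rewrite !inE => /or3P[]/eqP->.
have sk : same_pt (dp k (sg k)) p.
  have ksk : k != sg k by rewrite eq_sym sg_neq.
  case: s => e; subst i; apply: meet_unique; rewrite ?sgS -?ej //.
  by rewrite ej sgK in pj.
by move: kl sk; rewrite !inE => /or3P[]/eqP->;
  [constructor 1|constructor 2|constructor 3].
Qed.

Lemma Lambda23_line p : Lambda23 F S p <-> on_line p m.
Proof.
split=> [[v [/three_dp_same vm pv]]|pm]; first by rewrite -(same_line_on _ vm).
by exists m; split => //; apply: three_dp_m.
Qed.

End SixLines.

(** * Polynomials on a double plane *)

Section CharZeroPoly.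
Variable L : idomainType.
Hypothesis natr_neq0 : forall k, k.+1%:R != 0 :> L.

Lemma natr_inj0 : injective (fun k => k%:R : L).
Proof.
have lt_neq m n : (m < n)%N -> (m%:R : L) <> n%:R.
  move=> lt_mn /eqP; rewrite eq_sym -subr_eq0 -natrB 1?ltnW //.
  by have := natr_neq0 (n - m).-1; rewrite prednK ?subn_gt0 // => /negPf->.
by move=> m n; case: (ltngtP m n) => // /lt_neq h e; case: h.
Qed.

Lemma poly_natroots_eq0 (p : {poly L}) : (forall k, p.[k%:R] = 0) -> p = 0.
Proof.
move=> h; apply: (@roots_geq_poly_eq0 _ p [seq k%:R | k <- iota 0 (size p)]).
- by apply/allP => x /mapP[k _ ->]; apply/eqP/h.
- by rewrite map_inj_uniq ?iota_uniq //; apply: natr_inj0.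
- by rewrite size_map size_iota.
Qed.

Lemma deriv_eq0C (p : {poly L}) : p^`() = 0 -> p = (p`_0)%:P.
Proof.
move=> /polyP h; apply/polyP => -[|i]; rewrite coefC //=.
have := h i; rewrite coef_deriv coef0 -mulr_natr => /eqP.
by rewrite mulf_eq0 (negPf (natr_neq0 i)) orbF => /eqP.
Qed.

End CharZeroPoly.

(* Infinite descent: ['X] divides the right-hand side to an odd order. *)
Lemma nonsquare_poly (K : idomainType) (E b f : {poly K}) :
  E.[0] != 0 -> f ^+ 2 = b ^+ 2 * ('X * E) -> b = 0.
Proof.
move=> E0; have [n] := ubnP (size b); elim: n b f => // n IHn b f.
rewrite ltnS => le_bn e.
have X0 : 'X != 0 :> {poly K} by rewrite polyX_eq0.
have [//|b0] := eqVneq b 0.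
have factorX (p : {poly K}) : p.[0] = 0 -> exists q, p = q * 'X.
  by move=> /eqP/factor_theorem[q ->]; exists q; rewrite subr0.
have [g ef] : exists g, f = g * 'X.
  apply: factorX; apply/eqP; rewrite -sqrf_eq0 -horner_exp e !hornerM hornerX.
  by rewrite mul0r mulr0.
have e1 : 'X * g ^+ 2 = b ^+ 2 * E.
  apply: (mulfI X0); transitivity (f ^+ 2); first by rewrite ef; ring.
  by rewrite e; ring.
have [c eb] : exists c, b = c * 'X.
  apply: factorX; apply/eqP; rewrite -sqrf_eq0 -(mulIr_eq0 _ (mulIf E0)).
  by rewrite -horner_exp -hornerM -e1 hornerM hornerX mul0r.
have c0 : c = 0.
  apply: (IHn c g).
    move: le_bn; rewrite eb size_mulX //.
    by apply: contra_neq b0 => c0; rewrite eb c0 mul0r.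
  apply: (mulfI X0); rewrite e1 eb; ring.
by rewrite eb c0 mul0r.
Qed.

(** In a nested polynomial ring, the partial derivatives in the inner variables act on coefficients;
    this makes them derivations of the whole ring. *)
Lemma map_poly_Leibniz (K : comNzRingType) (D : {additive K -> K}) :
  (forall x y, D (x * y) = D x * y + x * D y) ->
  forall p q : {poly K}, map_poly D (p * q) = map_poly D p * q + p * map_poly D q.
Proof.
move=> DM p q; apply/polyP => n.
rewrite coefD !coefM coef_map /= coefM raddf_sum -big_split.
by apply: eq_bigr => i _; rewrite /= !coef_map DM.
Qed.

Lemma map_polyX_const (K : comNzRingType) (D : {additive K -> K}) :
  D 1 = 0 -> map_poly D 'X = 0.
Proof.
move=> D1; apply/polyP => i; rewrite coef_map coefX coef0 /=.
by case: eqP => _; rewrite ?D1 ?raddf0.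
Qed.

Section NestedPolynomials.
Variable C : numClosedFieldType.

(* Polynomials in (u, w), with w outermost, and in (u, v, w), with v outermost. *)
Definition poly2 := {poly {poly C}}.
Definition poly3 := {poly poly2}.

Definition cst2 (c : C) : poly2 := c%:P%:P.
Definition cst3 (c : C) : poly3 := (cst2 c)%:P.

Definition ev2 (u w : C) : poly2 -> C := horner_eval u \o horner_eval w%:P.
HB.instance Definition _ u w := GRing.RMorphism.copy (ev2 u w)
  (horner_eval u \o horner_eval w%:P).

Definition ev3 (u v w : C) : poly3 -> C := ev2 u w \o horner_eval (cst2 v).
HB.instance Definition _ u v w := GRing.RMorphism.copy (ev3 u v w)
  (ev2 u w \o horner_eval (cst2 v)).

Lemma ev2D u w a b : ev2 u w (a + b) = ev2 u w a + ev2 u w b.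
Proof. exact: rmorphD. Qed.

Lemma ev2N u w a : ev2 u w (- a) = - ev2 u w a.
Proof. exact: rmorphN. Qed.

Lemma ev2M u w a b : ev2 u w (a * b) = ev2 u w a * ev2 u w b.
Proof. exact: rmorphM. Qed.

Lemma ev2X u w a k : ev2 u w (a ^+ k) = ev2 u w a ^+ k.
Proof. exact: rmorphXn. Qed.

Lemma ev2_nat u w k : ev2 u w k%:R = k%:R.
Proof. exact: rmorph_nat. Qed.

Lemma ev3D u v w a b : ev3 u v w (a + b) = ev3 u v w a + ev3 u v w b.
Proof. exact: rmorphD. Qed.

Lemma ev3N u v w a : ev3 u v w (- a) = - ev3 u v w a.
Proof. exact: rmorphN. Qed.

Lemma ev3M u v w a b : ev3 u v w (a * b) = ev3 u v w a * ev3 u v w b.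
Proof. exact: rmorphM. Qed.

Lemma ev3X u v w a k : ev3 u v w (a ^+ k) = ev3 u v w a ^+ k.
Proof. exact: rmorphXn. Qed.

Lemma ev3_0 u v w : ev3 u v w 0 = 0.
Proof. exact: rmorph0. Qed.

Lemma ev3_1 u v w : ev3 u v w 1 = 1.
Proof. exact: rmorph1. Qed.

Lemma ev2_0 u w : ev2 u w 0 = 0.
Proof. exact: rmorph0. Qed.

Lemma ev2_1 u w : ev2 u w 1 = 1.
Proof. exact: rmorph1. Qed.

Definition ev2R := (ev2D, ev2N, ev2M, ev2X).
Definition ev3R := (ev3D, ev3N, ev3M, ev3X).

Lemma ev2_cst u w c : ev2 u w (cst2 c) = c.
Proof. by rewrite /ev2 /= /horner_eval !hornerC. Qed.

Lemma ev2_u u w : ev2 u w 'X%:P = u.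
Proof. by rewrite /ev2 /= /horner_eval hornerC hornerX. Qed.

Lemma ev2_w u w : ev2 u w 'X = w.
Proof. by rewrite /ev2 /= /horner_eval hornerX hornerC. Qed.

Lemma ev3C u v w a : ev3 u v w a%:P = ev2 u w a.
Proof. by rewrite /ev3 /= /horner_eval hornerC. Qed.

Lemma ev3_v u v w : ev3 u v w 'X = v.
Proof. by rewrite /ev3 /= /horner_eval hornerX ev2_cst. Qed.

Definition ev3E := (ev3C, ev3_v, ev2_u, ev2_w, ev2_cst).

Lemma natr_neq0_C k : k.+1%:R != 0 :> C.
Proof. by rewrite pnatr_eq0. Qed.

Lemma natr_neq0_polyC k : k.+1%:R != 0 :> {poly C}.
Proof. by rewrite -polyC_natr polyC_eq0 natr_neq0_C. Qed.

Lemma ev2_eq0 (n : poly2) : (forall u w, ev2 u w n = 0) -> n = 0.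
Proof.
move=> h; apply: (poly_natroots_eq0 natr_neq0_polyC) => k.
apply: (poly_natroots_eq0 natr_neq0_C) => l.
by have := h l%:R k%:R; rewrite /ev2 /= /horner_eval polyC_natr.
Qed.

Lemma poly2_ind (P : poly2 -> Prop) :
  (forall c, P (cst2 c)) -> P 'X%:P -> P 'X ->
  (forall a b, P a -> P b -> P (a + b)) -> (forall a b, P a -> P b -> P (a * b)) ->
  forall n, P n.
Proof.
move=> Pc Pu Pw PD PM.
have Pp (p : {poly C}) : P p%:P.
  elim/poly_ind: p => [|p a IHp]; first exact: (Pc 0).
  rewrite polyCD polyCM; apply: (PD _ _ (PM _ _ IHp Pu)); exact: Pc.
elim/poly_ind => [|n c IHn]; first exact: (Pc 0).
exact: PD _ _ (PM _ _ IHn Pw) (Pp c).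
Qed.

Definition derivation (d : poly3 -> poly3) :=
  [/\ forall x y, d (x + y) = d x + d y,
      forall x y, d (x * y) = d x * y + x * d y
    & forall c, d (cst3 c) = 0].

Definition d_u : poly3 -> poly3 := map_poly (map_poly (@deriv C)).
Definition d_v : poly3 -> poly3 := @deriv poly2.
Definition d_w : poly3 -> poly3 := map_poly (@deriv {poly C}).

Lemma d_u_derivation : derivation d_u.
Proof.
split=> [x y|x y|c]; first exact: raddfD.
  apply: map_poly_Leibniz => a b; apply: map_poly_Leibniz => p q.
  exact: derivM.
by rewrite /d_u /cst3 /cst2 map_polyC /= map_polyC /= derivC.
Qed.

Lemma d_v_derivation : derivation d_v.
Proof. by split=> [x y|x y|c]; rewrite /d_v ?derivD ?derivM ?derivC. Qed.

Lemma d_w_derivation : derivation d_w.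
Proof.
split=> [x y|x y|c]; first exact: raddfD.
  apply: map_poly_Leibniz => a b; exact: derivM.
by rewrite /d_w /cst3 /cst2 map_polyC /= derivC.
Qed.

Lemma d_uE : (d_u 'X%:P%:P = 1) * (d_u 'X%:P = 0) * (d_u 'X = 0).
Proof.
have D0 : map_poly (@deriv C) 'X = 0 by apply: map_polyX_const; exact: (derivC 1).
rewrite /d_u map_polyC /= map_polyC /= derivX map_polyC /= D0; split => //.
by apply: map_polyX_const; rewrite /= map_polyC /=; congr _%:P; exact: (derivC 1).
Qed.

Lemma d_wE : (d_w 'X%:P%:P = 0) * (d_w 'X%:P = 1) * (d_w 'X = 0).
Proof.
rewrite /d_w map_polyC /= derivC map_polyC /= derivX; split => //.
by apply: map_polyX_const; exact: (derivC 1).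
Qed.

Lemma d_vE : (d_v 'X%:P%:P = 0) * (d_v 'X%:P = 0) * (d_v 'X = 1).
Proof. by rewrite /d_v !derivC derivX. Qed.

End NestedPolynomials.

(** * Functions on the surface, a double cover of the (u, w)-plane *)

Section Surface.
Variable C : numClosedFieldType.
Variables (a2 a1 a0 : poly2 C) (E : {poly {poly C}}).
Hypothesis a2_neq0 : a2 != 0.
Hypothesis disc_odd : a1 ^+ 2 - 4%:R * a2 * a0 = 'X * E.
Hypothesis E0 : E.[0] != 0.

Definition quadric : poly3 C := a2%:P * 'X ^+ 2 + a1%:P * 'X + a0%:P.

Lemma ev_quadric u v w :
  ev3 u v w quadric = ev2 u w a2 * v ^+ 2 + ev2 u w a1 * v + ev2 u w a0.
Proof. by rewrite /quadric !ev3R !ev3E. Qed.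

(** Pseudo-division in [v]. The power of the leading coefficient is what brings in the conditions
    [ev2 u w a2 != 0] below. *)
Lemma reduce_quadric (T : poly3 C) : exists k M a b,
  (a2 ^+ k)%:P * T = quadric * M + a%:P + b%:P * 'X.
Proof.
elim/poly_ind: T => [|T c [k [M [a [b e]]]]].
  by exists 0%N, 0, 0, 0; rewrite !mulr0 polyC0 mul0r !addr0.
exists k.+1, (a2%:P * 'X * M + b%:P), (a2 ^+ k.+1 * c - b * a0), (a2 * a - b * a1).
have eP : (a2 ^+ k.+1)%:P = a2%:P * (a2 ^+ k)%:P by rewrite exprS polyCM.
rewrite !polyCB !(polyCM _ c) !(polyCM a2) !(polyCM b) eP.
transitivity (a2%:P * 'X * ((a2 ^+ k)%:P * T) + a2%:P * (a2 ^+ k)%:P * c%:P).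
  by ring.
by rewrite e /quadric; ring.
Qed.

(** The form is [a2] times the norm of a + b v. Multiplied by [4 * a2] it becomes
    [(2 a2 a - a1 b)^2 - b^2 disc], and the discriminant, being divisible by w exactly once, is not
    a square. *)
Lemma norm_eq0 (a b : poly2 C) :
  a2 * a ^+ 2 - a * b * a1 + b ^+ 2 * a0 = 0 -> a = 0 /\ b = 0.
Proof.
move=> n0; have b0 : b = 0.
  apply: (@nonsquare_poly _ E b (2%:R * a2 * a - a1 * b) E0).
  rewrite -disc_odd; apply/eqP; rewrite -subr_eq0.
  set x := (X in X == 0).
  have -> : x = 4%:R * a2 * (a2 * a ^+ 2 - a * b * a1 + b ^+ 2 * a0).
    by rewrite /x; ring.
  by rewrite n0 mulr0.
split => //; move: n0; rewrite b0 !mulr0 mul0r expr0n /= mul0r subr0 addr0.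
by move=> /eqP; rewrite mulf_eq0 (negPf a2_neq0) sqrf_eq0 => /eqP.
Qed.

Section Generic.
Variables (N : poly3 C) (u0 v0 w0 : C).
Hypothesis quadric_z0 : ev3 u0 v0 w0 quadric = 0.
Hypothesis a2_z0 : ev2 u0 w0 a2 != 0.
Hypothesis N_z0 : ev3 u0 v0 w0 N != 0.

(** Over a general (u, w) the surface has two points, and [N] vanishes at neither. The remainder a +
    b v of [T] thus vanishes at two values of [v], so a = b = 0. The conclusion is a divisibility,
    not just vanishing, so that it can be differentiated. *)
Lemma vanish_dense (T : poly3 C) :
  (forall u v w, ev3 u v w quadric = 0 -> ev3 u v w N != 0 -> ev3 u v w T = 0) ->
  exists k M, (a2 ^+ k)%:P * T = quadric * M.
Proof.
move=> T0; have [k [M [a [b eT]]]] := reduce_quadric T.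
have [j [M' [c [d eN]]]] := reduce_quadric N.
have [nN enN] : exists n, n = a2 * c ^+ 2 - c * d * a1 + d ^+ 2 * a0 by eexists.
have evN u v w : ev3 u v w quadric = 0 ->
    ev2 u w a2 ^+ j * ev3 u v w N = ev2 u w c + ev2 u w d * v.
  move=> q0; have := congr1 (ev3 u v w) eN.
  by rewrite ev3M 2!ev3D 2!ev3M q0 mul0r add0r !ev3E ev2X.
have evT u v w : ev3 u v w quadric = 0 ->
    ev2 u w a2 ^+ k * ev3 u v w T = ev2 u w a + ev2 u w b * v.
  move=> q0; have := congr1 (ev3 u v w) eT.
  by rewrite ev3M 2!ev3D 2!ev3M q0 mul0r add0r !ev3E ev2X.
(* A zero norm would make the remainder of [N] zero, against [N_z0]. *)
have nN0 : nN != 0.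
  apply/eqP; rewrite enN => /norm_eq0[c0 d0]; have := evN _ _ _ quadric_z0.
  rewrite c0 d0 !ev2_0 mul0r addr0 => /eqP.
  by rewrite mulf_eq0 (negPf N_z0) orbF expf_eq0 (negPf a2_z0) andbF.
have D0 : a1 ^+ 2 - 4%:R * a2 * a0 != 0.
  rewrite disc_odd mulf_eq0 polyX_eq0 /=; apply: contra_neq E0 => ->.
  by rewrite horner0.
(* Where [pr] is nonzero, the equation is truly quadratic in [v], its roots are distinct, and [N]
   vanishes at neither. *)
pose pr := a2 * nN * (a1 ^+ 2 - 4%:R * a2 * a0).
have pr0 : pr != 0 by rewrite !mulf_neq0.
suff ab u w : ev2 u w pr != 0 -> ev2 u w a = 0 /\ ev2 u w b = 0.
  have cancel x : (forall u w, ev2 u w pr != 0 -> ev2 u w x = 0) -> x = 0.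
    move=> x0; apply: (mulfI pr0); rewrite mulr0; apply: ev2_eq0 => u w.
    rewrite ev2M.
    by have [->|/x0->] := eqVneq (ev2 u w pr) 0; rewrite ?mul0r ?mulr0.
  have az : a = 0 by apply: cancel => u w /ab[].
  have bz : b = 0 by apply: cancel => u w /ab[].
  by exists k, M; rewrite eT az bz polyC0 mul0r !addr0.
rewrite /pr 2!ev2M ev2D ev2N 2!ev2M ev2X ev2_nat.
rewrite !mulf_eq0 !negb_or => /andP[/andP[A2 nz] Dz].
set A := ev2 u w a2 in A2 evN evT Dz *; set B := ev2 u w a1 in Dz *.
set K := ev2 u w a0 in Dz *.
pose s := sqrtC (B ^+ 2 - 4%:R * A * K).
have s2 : s ^+ 2 = B ^+ 2 - 4%:R * A * K by rewrite sqrtCK.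
have s0 : s != 0 by rewrite -sqrf_eq0 s2.
have two : 2%:R != 0 :> C by rewrite pnatr_eq0.
pose r1 := (- B + s) / (2%:R * A); pose r2 := (- B - s) / (2%:R * A).
have q1 : ev3 u r1 w quadric = 0.
  rewrite ev_quadric -/A -/B -/K /r1.
  have -> : K = (B ^+ 2 - s ^+ 2) / (4%:R * A) by rewrite s2; field; rewrite A2.
  by field; rewrite A2.
have q2 : ev3 u r2 w quadric = 0.
  rewrite ev_quadric -/A -/B -/K /r2.
  have -> : K = (B ^+ 2 - s ^+ 2) / (4%:R * A) by rewrite s2; field; rewrite A2.
  by field; rewrite A2.
(* The norm as a product over the two conjugate points. *)
have prodN : A * ((ev2 u w c + ev2 u w d * r1) * (ev2 u w c + ev2 u w d * r2))
    = ev2 u w nN.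
  rewrite enN 2!ev2D ev2N !ev2M ?ev2X -/A -/B -/K /r1 /r2.
  have -> : K = (B ^+ 2 - s ^+ 2) / (4%:R * A) by rewrite s2; field; rewrite A2.
  by field; rewrite A2.
move: nz; rewrite -prodN !mulf_eq0 !negb_or => /and3P[_ n1 n2].
have N1 : ev3 u r1 w N != 0.
  by move: n1; rewrite -(evN _ _ _ q1) mulf_eq0 negb_or => /andP[].
have N2 : ev3 u r2 w N != 0.
  by move: n2; rewrite -(evN _ _ _ q2) mulf_eq0 negb_or => /andP[].
have := evT _ _ _ q1; rewrite T0 // mulr0 => e1.
have := evT _ _ _ q2; rewrite T0 // mulr0 => e2.
have b0 : ev2 u w b = 0.
  have : ev2 u w b * (s / A) = 0.
    transitivity ((ev2 u w a + ev2 u w b * r1) - (ev2 u w a + ev2 u w b * r2)).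
      by rewrite /r1 /r2; field; rewrite A2.
    by rewrite -e1 -e2 subr0.
  by move/eqP; rewrite !mulf_eq0 invr_eq0 (negPf s0) (negPf A2) !orbF => /eqP.
by split => //; move: e1; rewrite b0 mul0r addr0.
Qed.

Lemma vanish_everywhere (T : poly3 C) :
  (forall u v w, ev3 u v w quadric = 0 -> ev3 u v w N != 0 -> ev3 u v w T = 0) ->
  forall u v w, ev3 u v w quadric = 0 -> ev2 u w a2 != 0 -> ev3 u v w T = 0.
Proof.
move=> /vanish_dense[k [M e]] u v w q0 A2.
have : ev3 u v w ((a2 ^+ k)%:P * T) = 0 by rewrite e ev3M q0 mul0r.
rewrite ev3M ev3C ev2X => /eqP.
by rewrite mulf_eq0 expf_eq0 (negPf A2) andbF => /eqP.
Qed.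

(* Vector fields tangent to the surface [quadric = 0]. *)
Definition tan_u (T : poly3 C) := d_v quadric * d_u T - d_u quadric * d_v T.
Definition tan_w (T : poly3 C) := d_v quadric * d_w T - d_w quadric * d_v T.

Lemma derivation_comb (p r : poly3 C) d e :
  derivation d -> derivation e -> derivation (fun T => p * d T - r * e T).
Proof.
move=> [dD dM dc] [eD eM ec]; split=> [x y|x y|c].
- by rewrite dD eD; ring.
- by rewrite dM eM; ring.
- by rewrite dc ec; ring.
Qed.

Lemma tan_u_derivation : derivation tan_u.
Proof. exact: derivation_comb (d_u_derivation C) (d_v_derivation C). Qed.

Lemma tan_w_derivation : derivation tan_w.
Proof. exact: derivation_comb (d_w_derivation C) (d_v_derivation C). Qed.

Lemma tan_u_quadric : tan_u quadric = 0.
Proof. by rewrite /tan_u [X in _ - X]mulrC subrr. Qed.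

Lemma tan_w_quadric : tan_w quadric = 0.
Proof. by rewrite /tan_w [X in _ - X]mulrC subrr. Qed.

(** Apply [d] to [a2 ^+ k * T = quadric * M]. On the surface the terms containing [T], [quadric] or
    [d quadric] drop out, and [a2 ^+ k * d T] remains. *)
Lemma tangent_vanish d (T : poly3 C) : derivation d -> d quadric = 0 ->
  (forall u v w, ev3 u v w quadric = 0 -> ev3 u v w N != 0 -> ev3 u v w T = 0) ->
  forall u v w, ev3 u v w quadric = 0 -> ev2 u w a2 != 0 -> ev3 u v w (d T) = 0.
Proof.
move=> [dD dM _] dq T0 u v w q0 A2; have [k [M e]] := vanish_dense T0.
have := congr1 (fun x => ev3 u v w (d x)) e.
rewrite !dM dq 2!ev3D 4!ev3M q0 (vanish_everywhere T0 q0 A2).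
rewrite ev3_0 mulr0 !mul0r !add0r ev3C ev2X => /eqP.
by rewrite mulf_eq0 expf_eq0 (negPf A2) andbF => /eqP.
Qed.

(** * Dominance from a nonzero Jacobian *)

Section Dominance.
Variables f1 h1 f2 h2 : poly3 C.

(** The numerator of the derivative of f / h. Up to the factor [(h1 * h2) ^+ 2], [jacobian] is the
    Jacobian determinant of [(f1 / h1, f2 / h2)] along the two tangent fields. *)
Definition wronskian (d : poly3 C -> poly3 C) f h := d f * h - f * d h.
Definition jacobian := wronskian tan_u f1 h1 * wronskian tan_w f2 h2
                       - wronskian tan_w f1 h1 * wronskian tan_u f2 h2.

Hypothesis N_ok : forall u v w, ev3 u v w quadric = 0 -> ev3 u v w N != 0 ->
  [/\ ev2 u w a2 != 0, ev3 u v w h1 != 0, ev3 u v w h2 != 0 & ev3 u v w jacobian != 0].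

Let x u v w := ev3 u v w f1 / ev3 u v w h1.
Let y u v w := ev3 u v w f2 / ev3 u v w h2.

Definition dx d u v w := ev3 u v w (wronskian d f1 h1) / ev3 u v w h1 ^+ 2.
Definition dy d u v w := ev3 u v w (wronskian d f2 h2) / ev3 u v w h2 ^+ 2.

Let H := h1 * h2.

(** The logarithmic derivative avoids the truncated exponent [k.-1], which keeps the identities of
    [pullback] within reach of [field]. *)
Lemma derivation_exp d (h : poly3 C) k u v w : derivation d -> ev3 u v w h != 0 ->
  ev3 u v w (d (h ^+ k)) =
    k%:R * ev3 u v w h ^+ k * (ev3 u v w (d h) / ev3 u v w h).
Proof.
move=> [dD dM dc] h0; elim: k => [|k IHk].
  rewrite expr0 mul0r mul0r.
  have -> : 1 = cst3 1 :> poly3 C by rewrite /cst3 /cst2 !polyC1.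
  by rewrite dc ev3_0.
rewrite exprS dM ev3D !ev3M ev3X IHk -natr1 exprS.
by field.
Qed.

(* [T] is [n(f1/h1, f2/h2)] with its denominators cleared. *)
Lemma pullback (n : poly2 C) : exists k T,
  forall u v w, ev3 u v w h1 != 0 -> ev3 u v w h2 != 0 ->
  ev3 u v w T = ev3 u v w H ^+ k * ev2 (x u v w) (y u v w) n /\
  forall d, derivation d ->
    ev3 u v w (d T) = k%:R * ev3 u v w H ^+ k * (ev3 u v w (d H) / ev3 u v w H)
                        * ev2 (x u v w) (y u v w) n
      + ev3 u v w H ^+ k *
        (ev2 (x u v w) (y u v w) (map_poly (@deriv C) n) * dx d u v w
         + ev2 (x u v w) (y u v w) n^`() * dy d u v w).
Proof.
elim/poly2_ind: n => [c||| a b [k [T hT]] [l [S hS]] | a b [k [T hT]] [l [S hS]]].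
- exists 0%N, (cst3 c) => u v w h10 h20.
  rewrite expr0 mul1r !ev3E; split => // d [_ _ ->].
  by rewrite ev3_0 derivC map_polyC /= derivC !ev2_0 !mul0r addr0 mulr0 addr0.
- exists 1%N, (f1 * h2) => u v w h10 h20; rewrite ev2_u expr1 /H; split.
    by rewrite !ev3M /x; field.
  move=> d [dD dM dc]; rewrite derivC map_polyC /= derivX ev2_0 ev2_1.
  by rewrite !dM /dx /x /wronskian !(ev3D, ev3N, ev3M); field; rewrite ?h10 ?h20.
- exists 1%N, (f2 * h1) => u v w h10 h20; rewrite ev2_w expr1 /H; split.
    by rewrite !ev3M /y; field.
  move=> d [dD dM dc]; rewrite derivX map_polyX_const ?ev2_0 ?ev2_1;
    last exact: (derivC 1).
  by rewrite !dM /dy /y /wronskian !(ev3D, ev3N, ev3M); field; rewrite ?h10 ?h20.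
- exists (k + l)%N, (H ^+ l * T + H ^+ k * S) => u v w h10 h20.
  have [eT dT] := hT u v w h10 h20; have [eS dS] := hS u v w h10 h20.
  have H0 : ev3 u v w H != 0 by rewrite ev3M mulf_neq0.
  split; first by rewrite !ev3D !(ev3M _ _ _ (_ ^+ _)) !ev3X eT eS exprD; ring.
  move=> d dd; have [dD dM dc] := dd.
  rewrite dD (dM (H ^+ l)) (dM (H ^+ k)) !ev3D !(ev3M _ _ _ (_ ^+ _)).
  rewrite !(ev3M _ _ _ (d _)) dT // dS // !derivation_exp //.
  by rewrite !ev3X eT eS derivD (raddfD (map_poly (@deriv C))) !ev2D exprD natrD; field.
exists (k + l)%N, (T * S) => u v w h10 h20.
have [eT dT] := hT u v w h10 h20; have [eS dS] := hS u v w h10 h20.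
have H0 : ev3 u v w H != 0 by rewrite ev3M mulf_neq0.
split; first by rewrite (ev3M _ _ _ T) eT eS ev2M exprD; ring.
move=> d dd; have [dD dM dc] := dd.
rewrite (dM T) ev3D (ev3M _ _ _ (d _)) (ev3M _ _ _ T) dT // dS // eT eS.
rewrite derivM map_poly_Leibniz; last exact: derivM.
by rewrite !ev2D !ev2M exprD natrD; field.
Qed.

Definition vanishes (n : poly2 C) := forall u v w,
  ev3 u v w quadric = 0 -> ev3 u v w N != 0 -> ev2 (x u v w) (y u v w) n = 0.

Lemma vanishes_deriv n : vanishes n -> vanishes (map_poly (@deriv C) n) /\ vanishes n^`().
Proof.
move=> n0; have [k [T hT]] := pullback n.
have T0 u v w : ev3 u v w quadric = 0 -> ev3 u v w N != 0 -> ev3 u v w T = 0.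
  move=> q0 Nz; have [_ h10 h20 _] := N_ok q0 Nz.
  by have [-> _] := hT u v w h10 h20; rewrite n0 // mulr0.
suff h u v w : ev3 u v w quadric = 0 -> ev3 u v w N != 0 ->
    ev2 (x u v w) (y u v w) (map_poly (@deriv C) n) = 0
    /\ ev2 (x u v w) (y u v w) n^`() = 0.
  by split => u v w q0 Nz; have [] := h u v w q0 Nz.
move=> q0 Nz; have [A2 h10 h20 J0] := N_ok q0 Nz.
have H0 : ev3 u v w H != 0 by rewrite ev3M mulf_neq0.
have lin d : derivation d -> d quadric = 0 ->
    ev2 (x u v w) (y u v w) (map_poly (@deriv C) n) * dx d u v w
    + ev2 (x u v w) (y u v w) n^`() * dy d u v w = 0.
  move=> dd dq; have := tangent_vanish dd dq T0 q0 A2.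
  have [_ ->] // := hT u v w h10 h20; rewrite n0 // mulr0 add0r => /eqP.
  by rewrite mulf_eq0 expf_eq0 (negPf H0) andbF => /eqP.
have e1 := lin _ tan_u_derivation tan_u_quadric.
have e2 := lin _ tan_w_derivation tan_w_quadric.
move: e1 e2; set p := ev2 _ _ (map_poly _ _); set r := ev2 _ _ n^`() => e1 e2.
have J1 : dx tan_u u v w * dy tan_w u v w - dx tan_w u v w * dy tan_u u v w != 0.
  have -> : dx tan_u u v w * dy tan_w u v w - dx tan_w u v w * dy tan_u u v w
      = ev3 u v w jacobian / (ev3 u v w h1 ^+ 2 * ev3 u v w h2 ^+ 2).
    have ev3_det (a b c d : poly3 C) : ev3 u v w (a * b - c * d)
        = ev3 u v w a * ev3 u v w b - ev3 u v w c * ev3 u v w d.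
      by rewrite ev3D ev3N !ev3M.
    by rewrite /dx /dy /jacobian ev3_det; field; rewrite h10 h20.
  by rewrite mulf_neq0 // invr_eq0 mulf_neq0 ?expf_neq0.
(* Cramer's rule for the linear system [e1], [e2] in the unknowns [p] and [r]. *)
split; apply: (mulIf J1); rewrite mul0r.
  transitivity ((p * dx tan_u u v w + r * dy tan_u u v w) * dy tan_w u v w
    - (p * dx tan_w u v w + r * dy tan_w u v w) * dy tan_u u v w); first by ring.
  by rewrite e1 e2; ring.
transitivity ((p * dx tan_w u v w + r * dy tan_w u v w) * dx tan_u u v w
    - (p * dx tan_u u v w + r * dy tan_u u v w) * dx tan_w u v w); first by ring.
by rewrite e1 e2; ring.
Qed.

(** Two nested inductions, on the degree in w and then in u; the constant left at the end is
    evaluated at the base point. *)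
Lemma vanishes_eq0 n : vanishes n -> n = 0.
Proof.
have vanishesC (c : C) : vanishes (cst2 c) -> c = 0.
  by move=> /(_ _ _ _ quadric_z0 N_z0); rewrite ev2_cst.
have vanishesP (p : {poly C}) : vanishes p%:P -> p = 0.
  have [m] := ubnP (size p); elim: m p => // m IHm p; rewrite ltnS => le_pm p0.
  have [->|pn0] := eqVneq p 0; first by [].
  have dp0 : p^`() = 0.
    apply: IHm; first exact: leq_trans (lt_size_deriv pn0) le_pm.
    by have [+ _] := vanishes_deriv p0; rewrite map_polyC.
  have ep := deriv_eq0C (@natr_neq0_C C) dp0; rewrite ep in p0 *.
  by rewrite (vanishesC _ p0) polyC0.
have [m] := ubnP (size n); elim: m n => // m IHm n; rewrite ltnS => le_nm n0.
have [->|nn0] := eqVneq n 0; first by [].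
have dn0 : n^`() = 0.
  apply: IHm; first exact: leq_trans (lt_size_deriv nn0) le_nm.
  by have [_ ] := vanishes_deriv n0.
have en := deriv_eq0C (@natr_neq0_polyC C) dn0; rewrite en in n0 *.
by rewrite (vanishesP _ n0) polyC0.
Qed.

(* The norm of [T] over C(u, w) vanishes at (f1/h1, f2/h2), hence is zero. *)
Lemma dominant (T : poly3 C) :
  (forall u v w, ev3 u v w quadric = 0 -> ev3 u v w N != 0 ->
     exists v', ev3 (x u v w) v' (y u v w) quadric = 0 /\
                ev3 (x u v w) v' (y u v w) T = 0) ->
  forall u v w, ev3 u v w quadric = 0 -> ev2 u w a2 != 0 -> ev3 u v w T = 0.
Proof.
move=> hT; have [k [M [a [b eT]]]] := reduce_quadric T.
have [] : a = 0 /\ b = 0.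
  apply: norm_eq0; apply: vanishes_eq0 => u v w q0 Nz.
  have [v' [q' T']] := hT u v w q0 Nz.
  set X := x u v w in q' T' *; set Y := y u v w in q' T' *.
  have e : ev2 X Y a = - (ev2 X Y b * v').
    apply/eqP; rewrite -addr_eq0; apply/eqP.
    have := congr1 (ev3 X v' Y) eT; rewrite ev3M 2!ev3D 2!ev3M q' T' !ev3E.
    by rewrite mulr0 mul0r add0r.
  rewrite !ev2R e.
  (* With a = - b v' the norm becomes b^2 times the equation of the surface at v'. *)
  transitivity (ev2 X Y b ^+ 2 * ev3 X v' Y quadric); last by rewrite q' mulr0.
  by rewrite ev_quadric; ring.
move=> a_0 b_0 u v w q0 A2; have := congr1 (ev3 u v w) eT.
rewrite a_0 b_0 polyC0 mul0r !addr0 !ev3M q0 mul0r ev3C ev2X => /eqP.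
by rewrite mulf_eq0 expf_eq0 (negPf A2) andbF => /eqP.
Qed.

End Dominance.
End Generic.
End Surface.

(** * Normal form of a realization *)

Notation o_ k := (@Ordinal 7 k isT).
Notation p_ k := (inl (o_ k) : lab).
Notation q_ k := (inr (o_ k) : lab).

Section Heptagon.
Variable R : comNzRingType.
Implicit Types u v w : R.

(* Normal form of a realization, as dual points: p_0, p_1, p_2, p_3 is the
   standard frame; then p_4 = (u, v, 1), p_5 = (w, u, 1), and the incidences
   determine p_6 and the q_c = [inr c]. *)
Definition hept_coord u v w (x : lab) : R * R * R :=
  match x with
  | inl a => nth (0, 0, 0)
      [:: (1, 0, 0); (0, 1, 0); (0, 0, 1); (1, 1, 1); (u, v, 1); (w, u, 1);
          (u * (w - 1), u * (u - 1), u * (u - 1) - (v - 1) * (w - 1))] a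
  | inr c => nth (0, 0, 0)
      [:: ((v - u) * w, u * (v - u), u * (1 - u) + w * (v - 1));
          (v * w - u * u, 0, v - u); (1, v, 1); (u * w, v * w, u);
          (w - 1, u - 1, 0); (0, 1, 1); (u, u, 1)] c
  end.

Definition hept u v w (x : lab) : 'rV[R]_3 := vec (hept_coord u v w x).

(** The bracket of [p_ 1], [p_ 6] and [q_ 0] in the coordinates above. *)
Definition surf u v w : R :=
  - (w * (w - 1)) * v ^+ 2 + w * (u ^+ 2 - u + w - 1) * v - u ^+ 2 * (u - 1).

(** The candidate for the line l''_j. The lines l'_(j+k) and l'_(j-k) meet in a double point for k =
    1, 2, 3; this line joins the first two of these points and will be shown to contain the
    third. *)
Definition join_line (A : lab -> 'rV[R]_3) (j : 'I_7) : 'rV[R]_3 :=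
  join4 (A (inr (j + 1))) (A (inr (j - 1))) (A (inr (j + 2%:R))) (A (inr (j - 2%:R))).

End Heptagon.

Lemma ord7P (P : 'I_7 -> Prop) :
  P (o_ 0) -> P (o_ 1) -> P (o_ 2) ->
  P (o_ 3) -> P (o_ 4) -> P (o_ 5) ->
  P (o_ 6) -> forall j, P j.
Proof.
move=> h0 h1 h2 h3 h4 h5 h6 [[|[|[|[|[|[|[|//]]]]]]] lt_j];
  [move: h0|move: h1|move: h2|move: h3|move: h4|move: h5|move: h6];
  congr P; exact/val_inj.
Qed.

(** * Realizations in terms of brackets, and the action of GL_3 with scalings *)

Section Realizations.
Variable C : fieldType.
Implicit Types (A : arr C) (g : 'M[C]_3) (s : lab -> C).

Definition br_spec A := forall x y z, x != y -> y != z -> x != z ->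
  (br (A x) (A y) (A z) == 0) = nonbasis x y z.

Lemma third_ord (a b : 'I_7) : exists c, (a != c) && (b != c).
Proof.
have [|c _] := @fresh_in _ [set: 'I_7] [:: a; b]; first by rewrite cardsT card_ord.
by rewrite !inE negb_or !(eq_sym c) => h; exists c.
Qed.

Lemma third_lab (x y : lab) : exists z, [/\ x != z, y != z & ~~ nonbasis x y z].
Proof.
case: x y => [a|a] [b|b]; have [c /andP[ac bc]] := third_ord a b.
- by exists (inl c).
- by exists (inr c).
- by exists (inr c).
- by exists (inr c).
Qed.

Lemma rank2_br (x y z : 'rV[C]_3) : br x y z != 0 -> \rank (col_mx x y) = 2%N.
Proof.
move=> b0; apply/eqP; rewrite -[_ == _]/(row_free (col_mx x y)).
apply: inj_row_free => v; rewrite -[v]hsubmxK mul_row_col.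
rewrite [lsubmx v]mx11_scalar [rsubmx v]mx11_scalar !mul_scalar_mx.
set a := lsubmx v 0 0; set b := rsubmx v 0 0 => e.
have e1 : a * br x y z = br (a *: x + b *: y) y z by rewrite /br !mxE; ring.
have e2 : b * br x y z = br x (a *: x + b *: y) z by rewrite /br !mxE; ring.
have a0 : a = 0 by apply: (mulIf b0); rewrite e1 e /br !mxE; ring.
have b_0 : b = 0 by apply: (mulIf b0); rewrite e2 e /br !mxE; ring.
by rewrite a0 b_0 !raddf0 row_mx0.
Qed.

(** Any two labels lie in a basis, so the brackets already force every vector to be nonzero and any
    two to be independent. *)
Lemma realizationP A : realization A <-> br_spec A.
Proof.
split=> [[_ _ h] x y z xy yz xz|h]; first by rewrite -det_triE h.
have basis x y : x != y -> exists z, br (A x) (A y) (A z) != 0.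
  move=> xy; have [z [xz yz nb]] := third_lab x y; exists z.
  by rewrite h // (negPf nb).
split=> [x|x y /basis[z]|x y z xy yz xz]; last by rewrite det_triE h.
  have [y xy] : exists y, x != y.
    by case: x => a; [exists (inr a)|exists (inl a)].
  have [z] := basis x y xy; apply: contra_neq => ->.
  by rewrite /br !mxE !mul0r !addr0.
exact: rank2_br.
Qed.

Lemma arr_act_realization g s A : g \in unitmx -> (forall x, s x != 0) ->
  realization A -> realization (arr_act g s A).
Proof.
rewrite unitmxE unitfE => g0 s0 /realizationP h; apply/realizationP => x y z xy yz xz.
by rewrite br_act -h // !mulf_eq0 !(negPf (s0 _)) (negPf g0).
Qed.

Lemma arr_act_join g s A j : join_line (arr_act g s A) j =
  (s (inr (j + 1)%R) * s (inr (j - 1)%R) * s (inr (j + 2%:R)%R) * s (inr (j - 2%:R)%R)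
   * \det g) *: (join_line A j *m g).
Proof. by rewrite /join_line /arr_act join4_act. Qed.

Lemma arr_actK g s A : g \in unitmx -> (forall x, s x != 0) ->
  arr_act g s (arr_act (invmx g) (fun x => (s x)^-1) A) =1 A.
Proof.
move=> gU s0 x; rewrite /arr_act -scalemxAl -mulmxA mulVmx // mulmx1 scalerA.
by rewrite divff // scale1r.
Qed.

Lemma arr_act_comp g h s t A :
  arr_act g s (arr_act h t A) =1 arr_act (h *m g) (fun x => s x * t x) A.
Proof. by move=> x; rewrite /arr_act -scalemxAl mulmxA scalerA. Qed.

End Realizations.

(** Each of these brackets is identically zero, [surf] or [- surf]: the remaining incidences amount
    to a single equation. *)
Lemma hept_nonbasis (C : fieldType) (u v w : C) : surf u v w = 0 ->
  forall a b c, nb_cond a b c ->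
  br (hept u v w (inl a)) (hept u v w (inl b)) (hept u v w (inr c)) = 0.
Proof.
move=> e a b c; move: c a b.
by do 3 (apply: ord7P); move=> // _; rewrite /br /hept !coordE /=;
  first [ring | transitivity (surf u v w); [rewrite /surf; ring | exact: e]
        | transitivity (- surf u v w); [rewrite /surf; ring | by rewrite e oppr0]].
Qed.

(* [K] lists the quotients of the seven determinants by [surf]. *)
Lemma hept_concurrent (C : fieldType) (u v w : C) j : surf u v w = 0 ->
  br (hept u v w (inr (j + 3%:R))) (hept u v w (inr (j - 3%:R)))
     (join_line (hept u v w) j) = 0.
Proof.
move=> e; pose K := [::
  - u^+2 - u*v + u + v*w;
  - u^+2*w - u^+2 + u*v*w + 2%:R*u*w + u - v*w - w;
  - u^+4 + u^+3*w + u^+2*v*w + u^+2*v - u*v*w^+2 - 2%:R*u*v*w + v*w^+2;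
  - u^+3 + u^+2 + u*v*w - u*w + u - v;
  u^+3*v - 2%:R*u^+3 + u^+2*v + u^+2*w - u*v^+2*w;
  u^+4 - u^+3*v - 2%:R*u^+3*w + 2%:R*u^+2*v*w + u^+2*w + u*v*w^+2
    - 2%:R*u*v*w - v^+2*w^+2 + v^+2*w;
  u^+2*v + u^+2*w - u^+2 - 2%:R*u*v*w + v*w].
transitivity (nth 0 K j * surf u v w); last by rewrite e mulr0.
by move: j; apply: ord7P; rewrite /join_line /join4 /br /hept !coordE /=;
  rewrite /surf; ring.
Qed.

Lemma join_line_dot (C : fieldType) (A : lab -> 'rV[C]_3) j :
  (br (A (inr (j + 1))) (A (inr (j - 1))) (join_line A j) = 0) *
  (br (A (inr (j + 2%:R))) (A (inr (j - 2%:R))) (join_line A j) = 0).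
Proof. by rewrite /join_line /join4 /br !mxE; split; ring. Qed.

(** * Reduction of a realization to the normal form *)

Section NormalForm.
Variable C : fieldType.
Implicit Types (A F : arr C).

Lemma realization_br0 A x y z : realization A -> uniq [:: x; y; z] -> nonbasis x y z ->
  br (A x) (A y) (A z) = 0.
Proof.
move=> /realizationP h; rewrite /= !inE negb_or => /and3P[/andP[xy xz] yz _] nb.
by apply/eqP; rewrite h.
Qed.

Lemma realization_br_neq0 A x y z : realization A -> uniq [:: x; y; z] ->
  ~~ nonbasis x y z -> br (A x) (A y) (A z) != 0.
Proof.
move=> /realizationP h; rewrite /= !inE negb_or => /and3P[/andP[xy xz] yz _] nb.
by rewrite h.
Qed.

Lemma vec_mul_tri (a b c : C) (x y z : 'rV[C]_3) :
  vec (a, b, c) *m tri x y z = a *: x + b *: y + c *: z.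
Proof. by apply/rowP => j; rewrite !mxE sum3E !mxE /=. Qed.

Lemma eq_of_sub (x y E : C) : x - y = E -> E = 0 -> x = y.
Proof. by move=> <- /subr0_eq. Qed.

Lemma cramer (x y z t : 'rV[C]_3) :
  br x y z *: t = br t y z *: x + br x t z *: y + br x y t *: z.
Proof. by apply: row3P; rewrite !mxE /br; ring. Qed.

Lemma frame_form A : realization A -> exists g s F,
  [/\ g \in unitmx, forall x, s x != 0, A =1 arr_act g s F,
      [/\ F (p_ 0) = vec (1, 0, 0), F (p_ 1) = vec (0, 1, 0) & F (p_ 2) = vec (0, 0, 1)]
    & F (p_ 3) = vec (1, 1, 1)].
Proof.
move=> rA; have nz x y z := @realization_br_neq0 A x y z rA.
set P0 := A (p_ 0); set P1 := A (p_ 1); set P2 := A (p_ 2); set P3 := A (p_ 3).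
have d0 : br P0 P1 P2 != 0 by apply: nz.
(* [al], [be], [ga] are the coordinates of [P3] in the basis [P0], [P1], [P2]; absorbing them into
   the rows of [g] sends (1, 1, 1) to [P3]. *)
have [al [al0 eal]] : exists a, a != 0 /\ a * br P0 P1 P2 = br P3 P1 P2.
  by exists (br P3 P1 P2 / br P0 P1 P2); rewrite divfK // mulf_neq0 ?invr_eq0 ?nz.
have [be [be0 ebe]] : exists b, b != 0 /\ b * br P0 P1 P2 = br P0 P3 P2.
  by exists (br P0 P3 P2 / br P0 P1 P2); rewrite divfK // mulf_neq0 ?invr_eq0 ?nz.
have [ga [ga0 ega]] : exists c, c != 0 /\ c * br P0 P1 P2 = br P0 P1 P3.
  by exists (br P0 P1 P3 / br P0 P1 P2); rewrite divfK // mulf_neq0 ?invr_eq0 ?nz.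
pose g := tri (al *: P0) (be *: P1) (ga *: P2).
have gU : g \in unitmx.
  by rewrite unitmxE unitfE det_triE br_scale !mulf_eq0 !negb_or al0 be0 ga0.
pose s (x : lab) := match x with
  | inl a => nth 1 [:: al^-1; be^-1; ga^-1] a | inr _ => 1 end.
have s0 x : s x != 0.
  by case: x => [a|a] /=; rewrite ?oner_eq0 //; move: a; apply: ord7P;
    rewrite /= ?invr_eq0 ?oner_eq0.
exists g, s, (arr_act (invmx g) (fun x => (s x)^-1) A); split => //.
- by move=> x; rewrite arr_actK.
- by rewrite /arr_act /= !invrK !scalemxAl; split; apply: (can_inj (mulmxK gU));
    rewrite mulmxKV // vec_mul_tri ?scale0r ?scale1r ?add0r ?addr0.
rewrite /arr_act /= invr1 scale1r; apply: (can_inj (mulmxK gU)).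
rewrite mulmxKV // vec_mul_tri !scale1r.
apply: (can_inj (scalerK d0)); rewrite cramer !scalerDr !scalerA.
by rewrite !(mulrC (br P0 P1 P2)) eal ebe ega.
Qed.

Lemma realization_ext A B : A =1 B -> realization A -> realization B.
Proof.
move=> e /realizationP h; apply/realizationP => x y z xy yz xz.
by rewrite -!e h.
Qed.

Lemma arr_act_realizationE g s A : g \in unitmx -> (forall x, s x != 0) ->
  realization (arr_act g s A) -> realization A.
Proof.
move=> gU s0; rewrite !realizationP => h x y z xy yz xz; rewrite -h // br_act.
by move: gU; rewrite unitmxE unitfE !mulf_eq0 !(negPf (s0 _)) => /negPf->.
Qed.

Lemma affine_frame_form A : realization A -> exists g s F,
  [/\ g \in unitmx, forall x, s x != 0, A =1 arr_act g s F,
      [/\ F (p_ 0) = vec (1, 0, 0), F (p_ 1) = vec (0, 1, 0) & F (p_ 2) = vec (0, 0, 1)]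
    & [/\ F (p_ 3) = vec (1, 1, 1), F (p_ 4) 0 i2 = 1 & F (p_ 5) 0 i2 = 1]].
Proof.
move=> rA; have [g [s [F [gU s0 eA [F0 F1 F2] F3]]]] := frame_form rA.
have rF : realization F by apply: arr_act_realizationE gU s0 (realization_ext eA rA).
(* The last coordinate of [F k] is its bracket with the first two frame vectors. *)
have nz k : uniq [:: p_ 0; p_ 1; k] -> ~~ nonbasis (p_ 0) (p_ 1) k -> F k 0 i2 != 0.
  move=> uk nk; have := realization_br_neq0 rF uk nk; apply: contra_neq => e.
  by rewrite F0 F1 /br !coordE /= e; ring.
have n4 : F (p_ 4) 0 i2 != 0 by apply: nz.
have n5 : F (p_ 5) 0 i2 != 0 by apply: nz.
pose t (x : lab) := match x with
  | inl a => nth 1 [:: 1; 1; 1; 1; F (p_ 4) 0 i2; F (p_ 5) 0 i2] a | inr _ => 1 end.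
have t0 x : t x != 0.
  by case: x => [a|a] /=; rewrite ?oner_eq0 //; move: a; apply: ord7P;
    rewrite /= ?invr_eq0 ?oner_eq0.
exists g, (fun x => s x * t x), (fun x => (t x)^-1 *: F x); split => //.
- by move=> x; rewrite mulf_neq0.
- by move=> x; rewrite eA /arr_act -scalemxAl scalerA mulfK.
- by rewrite /= invr1 !scale1r.
by rewrite /= invr1 !scale1r !mxE !mulVf.
Qed.

Lemma normal_form A : realization A -> exists g s u v w,
  [/\ g \in unitmx, forall x, s x != 0, A =1 arr_act g s (hept u v w) & surf u v w = 0].
Proof.
move=> rA; have [g [s [F [gU s0 eA [F0 F1 F2] [F3 F4 F5]]]]] := affine_frame_form rA.
have rF : realization F by apply: arr_act_realizationE gU s0 (realization_ext eA rA).
have zr x y z := @realization_br0 F x y z rF.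
have nz x y z := @realization_br_neq0 F x y z rF.
pose u := F (p_ 4) 0 i0; pose v := F (p_ 4) 0 i1; pose w := F (p_ 5) 0 i0.
have F4E : F (p_ 4) = vec (u, v, 1) by apply: row3P; rewrite vecE.
have u0 : u != 0.
  have := nz (p_ 1) (p_ 2) (p_ 4) isT isT; apply: contra_neq => e.
  by rewrite F1 F2 F4E e /br !coordE /=; ring.
suff [F5E Fs] : F (p_ 5) = vec (w, u, 1) /\
    (F (p_ 5) = vec (w, u, 1) -> surf u v w = 0 /\
     forall x, exists a, F x = a *: hept u v w x).
  have [e /(fin_all_exists)[t Ft]] := Fs F5E.
  have t0 x : t x != 0.
    have [F0x _ _] := rF; apply: contra_neq (F0x x) => tx.
    by rewrite Ft tx scale0r.
  exists g, (fun x => s x * t x), u, v, w; split => //.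
    by move=> x; rewrite mulf_neq0.
  by move=> x; rewrite eA /arr_act Ft -scalemxAl scalerA.
have [nq6 _ _] := rF.
(* Dually, q_6 lies on the lines p_0 p_5, p_1 p_4 and p_2 p_3. The last two determine it, and the
   first then makes the second coordinate of p_5 equal to u: three parameters remain. *)
have Q6 : F (q_ 6) = F (q_ 6) 0 i2 *: vec (u, u, 1) /\ F (p_ 5) 0 i1 = u.
  have e1 := zr (p_ 0) (p_ 5) (q_ 6) isT isT; have e2 := zr (p_ 1) (p_ 4) (q_ 6) isT isT.
  have e3 := zr (p_ 2) (p_ 3) (q_ 6) isT isT; move: e1 e2 e3 (nq6 (q_ 6)).
  rewrite F0 F1 F2 F3 F4E /br !coordE /= F5.
  set a := F (q_ 6) 0 i0; set b := F (q_ 6) 0 i1; set c := F (q_ 6) 0 i2.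
  set u' := F (p_ 5) 0 i1 => e1 e2 e3 q0.
  have ea : a = u * c.
    by apply/eqP; rewrite -subr_eq0; apply/eqP; rewrite -e2; ring.
  have eb : b = a.
    by apply/eqP; rewrite -subr_eq0; apply/eqP; rewrite -e3; ring.
  have ec : b = u' * c.
    by apply/esym/eqP; rewrite -subr_eq0; apply/eqP; rewrite -e1; ring.
  have c0 : c != 0.
    apply: contra_neq q0 => c0; apply: row3P; rewrite -/a -/b -/c !mxE ?eb ?ea ?c0 //;
      ring.
  split; last by apply: (mulIf c0); rewrite -ec eb ea.
  by apply: row3P; rewrite !mxE /= -/a -/b -/c ?eb ?ea; ring.
have F5E : F (p_ 5) = vec (w, u, 1) by apply: row3P; rewrite vecE //=; case: Q6.
split => // _; have {Q6}[Q6 _] := Q6.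
have u1 : u - 1 != 0.
  have := nz (p_ 1) (p_ 3) (p_ 4) isT isT; apply: contra_neq => e.
  transitivity (u - 1); last by [].
  by rewrite F1 F3 F4E /br !coordE /=; ring.
have w1 : w - 1 != 0.
  have := nz (p_ 1) (p_ 3) (p_ 5) isT isT; apply: contra_neq => e.
  transitivity (w - 1); last by [].
  by rewrite F1 F3 F5E /br !coordE /=; ring.
have vu : v - u != 0.
  have := nz (p_ 0) (p_ 4) (p_ 5) isT isT; apply: contra_neq => e.
  transitivity (v - u); last by [].
  by rewrite F0 F4E F5E /br !coordE /=; ring.
(* Each remaining point is found up to a scalar, which is nonzero because the point is. *)
have scaled x (d k : C) h : d != 0 -> d *: F x = k *: h ->
    exists2 a, a != 0 & F x = a *: h.
  move=> d0 e; have Fx : F x = (k / d) *: h.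
    by apply: (can_inj (scalerK d0)); rewrite e scalerA mulrC divfK.
  exists (k / d) => //; have [nF _ _] := rF; apply: contra_neq (nF x) => k0.
  by rewrite Fx k0 scale0r.
(* This q_c and the following ones are each the intersection of two known lines. [E1] and [E2] are
   its linear equations, and every coordinate identity is a combination of them. *)
have [k5 k50 Q5] : exists2 a, a != 0 & F (q_ 5) = a *: vec (0, 1, 1).
  have e1 := zr (p_ 0) (p_ 3) (q_ 5) isT isT; have e2 := zr (p_ 1) (p_ 2) (q_ 5) isT isT.
  rewrite F0 F3 in e1; rewrite F1 F2 in e2.
  set E1 := br _ _ _ in e1; set E2 := br _ _ _ in e2.
  apply: (@scaled _ 1 (F (q_ 5) 0 i1)); rewrite ?oner_eq0 //; apply: row3P.
  - by apply: (@eq_of_sub _ _ E2 _ e2); rewrite /E2 /br !coordE /=; ring.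
  - by rewrite !coordE /=; ring.
  - by apply: (@eq_of_sub _ _ E1 _ e1); rewrite /E1 /br !coordE /=; ring.
have [k4 k40 Q4] : exists2 a, a != 0 & F (q_ 4) = a *: vec (w - 1, u - 1, 0).
  have e1 := zr (p_ 0) (p_ 1) (q_ 4) isT isT; have e2 := zr (p_ 3) (p_ 5) (q_ 4) isT isT.
  rewrite F0 F1 in e1; rewrite F3 F5E in e2.
  set E1 := br _ _ _ in e1; set E2 := br _ _ _ in e2.
  apply: (scaled _ _ (F (q_ 4) 0 i1) _ u1); apply: row3P.
  - apply: (@eq_of_sub _ _ (- E2 + (u - w) * E1)); last by rewrite e1 e2; ring.
    by rewrite /E1 /E2 /br !coordE /=; ring.
  - by rewrite !coordE /=; ring.
  - apply: (@eq_of_sub _ _ ((u - 1) * E1)); last by rewrite e1 mulr0.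
    by rewrite /E1 /br !coordE /=; ring.
have [k2 k20 Q2] : exists2 a, a != 0 & F (q_ 2) = a *: vec (1, v, 1).
  have e1 := zr (p_ 1) (p_ 3) (q_ 2) isT isT; have e2 := zr (p_ 0) (p_ 4) (q_ 2) isT isT.
  rewrite F1 F3 in e1; rewrite F0 F4E in e2.
  set E1 := br _ _ _ in e1; set E2 := br _ _ _ in e2.
  apply: (@scaled _ 1 (F (q_ 2) 0 i2)); rewrite ?oner_eq0 //; apply: row3P.
  - by apply: (@eq_of_sub _ _ E1 _ e1); rewrite /E1 /br !coordE /=; ring.
  - apply: (@eq_of_sub _ _ (- E2)); last by rewrite e2 oppr0.
    by rewrite /E2 /br !coordE /=; ring.
  - by rewrite !coordE /=; ring.
have [k3 k30 Q3] : exists2 a, a != 0 & F (q_ 3) = a *: vec (u * w, v * w, u).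
  have e1 := zr (p_ 2) (p_ 4) (q_ 3) isT isT; have e2 := zr (p_ 1) (p_ 5) (q_ 3) isT isT.
  rewrite F2 F4E in e1; rewrite F1 F5E in e2.
  set E1 := br _ _ _ in e1; set E2 := br _ _ _ in e2.
  apply: (scaled _ _ (F (q_ 3) 0 i2) _ u0); apply: row3P.
  - apply: (@eq_of_sub _ _ (u * E2)); last by rewrite e2 mulr0.
    by rewrite /E2 /br !coordE /=; ring.
  - apply: (@eq_of_sub _ _ (E1 + v * E2)); last by rewrite e1 e2 mulr0 addr0.
    by rewrite /E1 /E2 /br !coordE /=; ring.
  - by rewrite !coordE /=; ring.
have [k1 k10 Q1] : exists2 a, a != 0 & F (q_ 1) = a *: vec (v * w - u * u, 0, v - u).
  have e1 := zr (p_ 0) (p_ 2) (q_ 1) isT isT; have e2 := zr (p_ 4) (p_ 5) (q_ 1) isT isT.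
  rewrite F0 F2 in e1; rewrite F4E F5E in e2.
  set E1 := br _ _ _ in e1; set E2 := br _ _ _ in e2.
  apply: (scaled _ _ (F (q_ 1) 0 i2) _ vu); apply: row3P.
  - apply: (@eq_of_sub _ _ (E2 + (w - u) * E1)); last by rewrite e1 e2 mulr0 addr0.
    by rewrite /E1 /E2 /br !coordE /=; ring.
  - apply: (@eq_of_sub _ _ (- (v - u) * E1)); last by rewrite e1 mulr0.
    by rewrite /E1 /br !coordE /=; ring.
  - by rewrite !coordE /=; ring.
have [k0 k00 Q0] : exists2 a, a != 0 &
    F (q_ 0) = a *: vec ((v - u) * w, u * (v - u), u * (1 - u) + w * (v - 1)).
  have e1 := zr (p_ 2) (p_ 5) (q_ 0) isT isT; have e2 := zr (p_ 3) (p_ 4) (q_ 0) isT isT.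
  rewrite F2 F5E in e1; rewrite F3 F4E in e2.
  set E1 := br _ _ _ in e1; set E2 := br _ _ _ in e2.
  apply: (scaled _ (u * (v - u)) (F (q_ 0) 0 i1)); first by rewrite mulf_neq0.
  apply: row3P.
  - apply: (@eq_of_sub _ _ (- (v - u) * E1)); last by rewrite e1 mulr0.
    by rewrite /E1 /br !coordE /=; ring.
  - by rewrite !coordE /=; ring.
  - apply: (@eq_of_sub _ _ (u * E2 - (v - 1) * E1)); last by rewrite e1 e2 !mulr0 subr0.
    by rewrite /E1 /E2 /br !coordE /=; ring.
(* p_6 is the intersection of the lines p_2 q_4 and p_4 q_5. *)
have [k6 k60 P6] : exists2 a, a != 0 &
    F (p_ 6) = a *: vec (u * (w - 1), u * (u - 1), u * (u - 1) - (v - 1) * (w - 1)).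
  have e1 := zr (p_ 2) (p_ 6) (q_ 4) isT isT; have e2 := zr (p_ 4) (p_ 6) (q_ 5) isT isT.
  have {}e1 : F (p_ 6) 0 i0 * (u - 1) - F (p_ 6) 0 i1 * (w - 1) = 0.
    by apply: (mulfI k40); rewrite mulr0 -e1 F2 Q4 /br !coordE /=; ring.
  have {}e2 : u * (F (p_ 6) 0 i1 - F (p_ 6) 0 i2) - (v - 1) * F (p_ 6) 0 i0 = 0.
    by apply: (mulfI k50); rewrite mulr0 -e2 F4E Q5 /br !coordE /=; ring.
  set E1 := _ - _ in e1; set E2 := u * _ - _ in e2.
  apply: (scaled _ (u * (u - 1)) (F (p_ 6) 0 i1)); first by rewrite mulf_neq0.
  apply: row3P.
  - apply: (@eq_of_sub _ _ (u * E1)); last by rewrite e1 mulr0.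
    by rewrite /E1 !coordE /=; ring.
  - by rewrite !coordE /=; ring.
  - apply: (@eq_of_sub _ _ (- (u - 1) * E2 - (v - 1) * E1));
      last by rewrite e1 e2 !mulr0 subr0.
    by rewrite /E1 /E2 !coordE /=; ring.
split.
  (* All coordinates are now known, so this further incidence becomes the equation of the
     surface. *)
  have e := zr (p_ 1) (p_ 6) (q_ 0) isT isT.
  apply: (mulfI k60); apply: (mulfI k00); rewrite !mulr0 -e F1 P6 Q0 /surf /br !coordE /=.
  by ring.
case; apply: ord7P; rewrite /hept /=.
- by exists 1; rewrite scale1r.
- by exists 1; rewrite scale1r.
- by exists 1; rewrite scale1r.
- by exists 1; rewrite scale1r.
- by exists 1; rewrite scale1r.
- by exists 1; rewrite scale1r.
- by exists k6.
- by exists k0.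
- by exists k1.
- by exists k2.
- by exists k3.
- by exists k4.
- by exists k5.
- by exists (F (q_ 6) 0 i2).
Qed.

End NormalForm.

(** * A generic integral point *)

Section Morphisms.
Variables (R S : comNzRingType) (f : {rmorphism R -> S}).

Lemma map_vec (t : R * R * R) : map_mx f (vec t) = vec (f t.1.1, f t.1.2, f t.2).
Proof. by apply: row3P; rewrite !coordE. Qed.

Lemma map_hept u v w x : map_mx f (hept u v w x) = hept (f u) (f v) (f w) x.
Proof.
rewrite /hept map_vec; congr vec.
by case: x; apply: ord7P; rewrite /= !(rmorphD, rmorphN, rmorphM, rmorph1, rmorph0).
Qed.

Lemma map_br x y z : f (br x y z) = br (map_mx f x) (map_mx f y) (map_mx f z).
Proof. by rewrite /br !(rmorphD, rmorphN, rmorphM) !mxE. Qed.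

Lemma map_join4 x y z t : map_mx f (join4 x y z t) =
  join4 (map_mx f x) (map_mx f y) (map_mx f z) (map_mx f t).
Proof. by rewrite /join4 map_mxB !map_mxZ !map_br. Qed.

Lemma map_surf u v w : f (surf u v w) = surf (f u) (f v) (f w).
Proof. by rewrite /surf !(rmorphD, rmorphN, rmorphM, rmorphXn, rmorph1). Qed.

End Morphisms.

Definition next (R : comNzRingType) (A : lab -> 'rV[R]_3) (x : lab) : 'rV[R]_3 :=
  match x with inl i => A (inr i) | inr j => join_line A j end.

Lemma map_next (R S : comNzRingType) (f : {rmorphism R -> S}) A x :
  map_mx f (next A x) = next (fun y => map_mx f (A y)) x.
Proof. by case: x => a //=; rewrite /join_line map_join4. Qed.

Definition distinct3 (x y z : lab) := [&& x != y, y != z & x != z].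

Definition mixed6 (a b c d e f : 'I_7) :=
  uniq [:: a; b; c; d; e; f] && ~~ ((a + b == c + d) && (c + d == e + f)).

(* The conditions that are generic in the realization: [next A] has no
   unwanted concurrency, and three double points on six disjoint lines of
   [C_1] are collinear only for the matching producing [join_line]. *)
Definition generic_arr (C : fieldType) (A : lab -> 'rV[C]_3) :=
  (forall x y z, distinct3 x y z -> ~~ nonbasis x y z ->
     br (next A x) (next A y) (next A z) != 0) /\
  (forall a b c d e f, mixed6 a b c d e f ->
     br (join4 (A (inr a)) (A (inr b)) (A (inr c)) (A (inr d)))
        (A (inr e)) (A (inr f)) != 0).

Section Triples.
Variable R : comNzRingType.
Implicit Types x y z t : R * R * R.

(** The bracket on plain triples, a form that [vm_compute] can evaluate over [Z]. *)
Definition brt x y z : R :=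
  x.1.1 * (y.1.2 * z.2 - y.2 * z.1.2) + x.1.2 * (y.2 * z.1.1 - y.1.1 * z.2)
  + x.2 * (y.1.1 * z.1.2 - y.1.2 * z.1.1).

Definition join4t x y z t : R * R * R :=
  let a := brt x y t in let b := brt x y z in
  (a * z.1.1 - b * t.1.1, a * z.1.2 - b * t.1.2, a * z.2 - b * t.2).

Lemma br_vec x y z : br (vec x) (vec y) (vec z) = brt x y z.
Proof. by rewrite /br !vecE. Qed.

Lemma join4_vec x y z t : join4 (vec x) (vec y) (vec z) (vec t) = vec (join4t x y z t).
Proof. by apply: row3P; rewrite /join4 !br_vec !coordE. Qed.

Variables u v w : R.

Definition next_coord (x : lab) : R * R * R :=
  let q j := hept_coord u v w (inr j) in
  match x with
  | inl i => q i
  | inr j => join4t (q (j + 1)) (q (j - 1)) (q (j + 2%:R)) (q (j - 2%:R))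
  end.

Lemma next_hept (k : lab) : next (hept u v w) k = vec (next_coord k).
Proof. by case: k => a //; rewrite /next /join_line /hept join4_vec. Qed.

Variables du dv dw : R.

(** For the q_c, the directional derivative of [hept_coord] along (du, dv, dw), in the shape given
    by the Leibniz rule. *)
Definition dhept_coord (x : lab) : R * R * R :=
  match x with
  | inr c => nth (0, 0, 0)
    [:: ((dv - du) * w + (v - u) * dw, du * (v - u) + u * (dv - du),
         du * (1 - u) - u * du + dw * (v - 1) + w * dv);
        (dv * w + v * dw - (du * u + u * du), 0, dv - du); (0, dv, 0);
        (du * w + u * dw, dv * w + v * dw, du); (dw, du, 0); (0, 0, 0); (du, du, 0)] c
  | inl _ => (0, 0, 0)
  end.

Definition dsurf : R :=
  - (dw * (w - 1) + w * dw) * v ^+ 2 - w * (w - 1) * (dv * v + v * dv)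
  + dw * (u ^+ 2 - u + w - 1) * v + w * (du * u + u * du - du + dw) * v
  + w * (u ^+ 2 - u + w - 1) * dv
  - (du * u + u * du) * (u - 1) - u ^+ 2 * du.

Definition bra (a b c : 'I_7) : R :=
  brt (hept_coord u v w (inr a)) (hept_coord u v w (inr b)) (hept_coord u v w (inr c)).

Definition dbra (a b c : 'I_7) : R :=
  let q i := hept_coord u v w (inr i) in let dq i := dhept_coord (inr i) in
  brt (dq a) (q b) (q c) + brt (q a) (dq b) (q c) + brt (q a) (q b) (dq c).

End Triples.

Definition int_of (C : numClosedFieldType) : Z -> C := intr \o int_of_Z.
HB.instance Definition _ (C : numClosedFieldType) :=
  GRing.RMorphism.copy (int_of C) (intr \o int_of_Z).

Lemma int_of_neq0 (C : numClosedFieldType) n : n != 0 -> int_of C n != 0.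
Proof.
rewrite /int_of /= intr_eq0; apply: contra_neq => e.
by rewrite -[n]int_of_ZK e.
Qed.

(** Explicit enumerations turn the finite checks below into boolean tests that compute. *)
Definition ords : seq 'I_7 :=
  [:: o_ 0; o_ 1; o_ 2; o_ 3;
      o_ 4; o_ 5; o_ 6].

Lemma allords (P : pred 'I_7) : all P ords -> forall i, P i.
Proof. by move=> /and5P[? ? ? ? /and4P[? ? ? _]]; apply: ord7P. Qed.

Definition labs : seq lab := map inl ords ++ map inr ords.

Lemma alllabs (P : pred lab) : all P labs -> forall x, P x.
Proof.
rewrite /labs all_cat !all_map => /andP[/allords hl /allords hr] [a|a].
  exact: hl.
exact: hr.
Qed.

(* Found by searching the integral points of [surf u v w = 0] for one at which
   all the genericity conditions hold. *)
Notation zu := (8%:R : Z).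
Notation zv := (- 2%:R : Z).
Notation zw := (- 7%:R : Z).

Lemma surf_point : surf zu zv zw = 0 :> Z.
Proof. by vm_compute. Qed.

Lemma hept_basis_point x y z : distinct3 x y z -> ~~ nonbasis x y z ->
  brt (hept_coord zu zv zw x) (hept_coord zu zv zw y) (hept_coord zu zv zw z) != 0.
Proof.
move=> d nb; have : all (fun x => all (fun y => all (fun z =>
    if distinct3 x y z && ~~ nonbasis x y z then
      brt (hept_coord zu zv zw x) (hept_coord zu zv zw y) (hept_coord zu zv zw z) != 0
    else true) labs) labs) labs by vm_compute.
by move=> /alllabs/(_ x)/alllabs/(_ y)/alllabs/(_ z); rewrite d nb.
Qed.

Lemma next_basis_point x y z : distinct3 x y z -> ~~ nonbasis x y z ->
  brt (next_coord zu zv zw x) (next_coord zu zv zw y) (next_coord zu zv zw z) != 0.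
Proof.
move=> d nb; have : all (fun x => all (fun y => all (fun z =>
    if distinct3 x y z && ~~ nonbasis x y z then
      brt (next_coord zu zv zw x) (next_coord zu zv zw y) (next_coord zu zv zw z) != 0
    else true) labs) labs) labs by vm_compute.
by move=> /alllabs/(_ x)/alllabs/(_ y)/alllabs/(_ z); rewrite d nb.
Qed.

Lemma mixed6_point a b c d e f : mixed6 a b c d e f ->
  let q i := hept_coord zu zv zw (inr i) in
  brt (join4t (q a) (q b) (q c) (q d)) (q e) (q f) != 0.
Proof.
(* There are 7^6 sextuples, at most 5040 of them mixed. Under [vm_compute] the [if] evaluates the
   bracket only for those. *)
move=> m; have : let q i := hept_coord zu zv zw (inr i) in
  all (fun a => all (fun b => all (fun c => all (fun d => all (fun e => all (fun f =>
    if mixed6 a b c d e f then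
      brt (join4t (q a) (q b) (q c) (q d)) (q e) (q f) != 0
    else true) ords) ords) ords) ords) ords) ords by vm_compute.
move=> /allords/(_ a)/allords/(_ b)/allords/(_ c)/allords/(_ d).
move=> /allords/(_ e)/allords/(_ f).
by rewrite m.
Qed.

Lemma generic_point (C : numClosedFieldType) :
  generic_arr (hept (int_of C zu) (int_of C zv) (int_of C zw)).
Proof.
have E x : hept (int_of C zu) (int_of C zv) (int_of C zw) x
    = map_mx (int_of C) (hept zu zv zw x) by rewrite map_hept.
split=> [x y z d nb|a b c d e f m].
  have E' t : next (hept (int_of C zu) (int_of C zv) (int_of C zw)) t
      = map_mx (int_of C) (next (hept zu zv zw) t).
    by rewrite map_next; case: t => i; rewrite /next /join_line ?E.
  rewrite !E' -map_br int_of_neq0 // !next_hept br_vec.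
  exact: next_basis_point.
rewrite !E -map_join4 -map_br int_of_neq0 // /hept join4_vec br_vec.
exact: mixed6_point.
Qed.

Lemma basis_point (C : numClosedFieldType)
  (A := hept (int_of C zu) (int_of C zv) (int_of C zw))
  x y z : distinct3 x y z -> ~~ nonbasis x y z -> br (A x) (A y) (A z) != 0.
Proof.
move=> d nb; rewrite /A -!map_hept -map_br int_of_neq0 // /hept br_vec.
exact: hept_basis_point.
Qed.

(* The normal form of [next A] has u = num_u q / den_u q and w = num_w q / den_w q
   for q = A \o inr. *)
Section NextCoordinates.
Variable R : comNzRingType.
Implicit Types q : 'I_7 -> 'rV[R]_3.
Definition num_u q := br (q (o_ 4)) (q (o_ 1)) (q (o_ 2))
                    * br (q (o_ 0)) (q (o_ 1)) (q (o_ 3)).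
Definition den_u q := br (q (o_ 3)) (q (o_ 1)) (q (o_ 2))
                    * br (q (o_ 0)) (q (o_ 1)) (q (o_ 4)).
Definition num_w q := br (q (o_ 5)) (q (o_ 1)) (q (o_ 2))
                    * br (q (o_ 0)) (q (o_ 1)) (q (o_ 3)).
Definition den_w q := br (q (o_ 3)) (q (o_ 1)) (q (o_ 2))
                    * br (q (o_ 0)) (q (o_ 1)) (q (o_ 5)).
End NextCoordinates.

(** * The surface as a quadric in v, and the Jacobian of the induced map *)

Section Jacobian.
Variable C : numClosedFieldType.

Definition cU : poly3 C := 'X%:P%:P.
Definition cV : poly3 C := 'X.
Definition cW : poly3 C := 'X%:P.
Definition pU : poly2 C := 'X%:P.
Definition pW : poly2 C := 'X.

Definition sa2 : poly2 C := - (pW * (pW - 1)).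
Definition sa1 : poly2 C := pW * (pU ^+ 2 - pU + pW - 1).
Definition sa0 : poly2 C := - (pU ^+ 2 * (pU - 1)).
Definition sE : poly2 C := pW * (pU ^+ 2 - pU + pW - 1) ^+ 2
                           - 4%:R * (pW - 1) * pU ^+ 2 * (pU - 1).

Lemma sa_disc : sa1 ^+ 2 - 4%:R * sa2 * sa0 = 'X * sE.
Proof. by rewrite /sa1 /sa2 /sa0 /sE -/pW; ring. Qed.

Lemma sE0 : sE.[0] != 0.
Proof.
(* At w = 0 the polynomial [sE] is 4 u^2 (u - 1), which is 16 at u = 2. *)
have : ev2 2%:R 0 sE != 0.
  rewrite /sE /pU /pW !(ev2D, ev2N, ev2M) !ev2_u !ev2_w !ev2_1.
  set x := (X in X != 0); have -> : x = 16%:R by rewrite /x; ring.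
  by rewrite pnatr_eq0.
apply: contra_neq => e; by rewrite /ev2 /= /horner_eval polyC0 e horner0.
Qed.

Lemma sa2_neq0 : sa2 != 0.
Proof.
have : ev2 0 2%:R sa2 != 0.
  rewrite /sa2 /pW !(ev2D, ev2N, ev2M) !ev2_w !ev2_1 -[_ != 0]/(_ != 0).
  by rewrite oppr_eq0 mulf_neq0 ?pnatr_eq0 // -[2%:R]/(1 + 1) addrK oner_eq0.
by apply: contra_neq => ->; rewrite ev2_0.
Qed.

Lemma quadric_surf : quadric sa2 sa1 sa0 = surf cU cV cW.
Proof.
rewrite /quadric /sa2 /sa1 /sa0 /surf /cU /cV /cW -/pU -/pW.
by rewrite !(polyCN, polyCD, polyCB, polyCM, polyC_exp) !polyC1; ring.
Qed.

Lemma ev3_U u v w : ev3 u v w cU = u.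
Proof. by rewrite /cU ev3C ev2_u. Qed.

Lemma ev3_V u v w : ev3 u v w cV = v.
Proof. exact: ev3_v. Qed.

Lemma ev3_W u v w : ev3 u v w cW = w.
Proof. by rewrite /cW ev3C ev2_w. Qed.

End Jacobian.

(** * Derivations at a point *)

Section PointDerivation.
Variables (K C : comNzRingType) (e : {rmorphism K -> C}) (De : K -> C).
Hypothesis DeD : forall a b, De (a + b) = De a + De b.
Hypothesis DeM : forall a b, De (a * b) = De a * e b + e a * De b.
Variables U V W : K.

Lemma De0 : De 0 = 0.
Proof. by apply: (addrI (De 0)); rewrite -DeD !addr0. Qed.

Lemma De1 : De 1 = 0.
Proof.
apply: (addrI (De 1)); rewrite addr0.
by have := DeM 1 1; rewrite rmorph1 !mulr1 mul1r => <-.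
Qed.

Lemma DeN a : De (- a) = - De a.
Proof. by apply/eqP; rewrite -addr_eq0 -DeD addNr De0. Qed.

Definition DeR := (DeD, DeN, DeM, De1, De0).

Lemma De_surf u v w : e U = u -> e V = v -> e W = w ->
  De (surf U V W) = dsurf u v w (De U) (De V) (De W).
Proof.
move=> <- <- <-; rewrite /surf /dsurf !expr2 !DeR !(rmorphD, rmorphN, rmorphM, rmorph1).
by ring.
Qed.

Lemma De_hept (c : 'I_7) : map_mx De (hept U V W (inr c)) =
  vec (dhept_coord (e U) (e V) (e W) (De U) (De V) (De W) (inr c)).
Proof.
by move: c; apply: ord7P; apply: row3P; rewrite !coordE /= ?DeR
  ?(rmorphD, rmorphN, rmorphM, rmorph1); ring.
Qed.

Lemma De_br x y z : De (br x y z) =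
  br (map_mx De x) (map_mx e y) (map_mx e z) + br (map_mx e x) (map_mx De y) (map_mx e z)
  + br (map_mx e x) (map_mx e y) (map_mx De z).
Proof.
by rewrite /br !DeR !(rmorphD, rmorphN, rmorphM) !mxE; ring.
Qed.

Lemma De_bra u v w : e U = u -> e V = v -> e W = w -> forall a b c,
  De (br (hept U V W (inr a)) (hept U V W (inr b)) (hept U V W (inr c)))
  = dbra u v w (De U) (De V) (De W) a b c.
Proof.
by move=> <- <- <- a b c; rewrite De_br !De_hept !map_hept /hept !br_vec.
Qed.

Lemma e_bra u v w : e U = u -> e V = v -> e W = w -> forall a b c,
  e (br (hept U V W (inr a)) (hept U V W (inr b)) (hept U V W (inr c))) = bra u v w a b c.
Proof. by move=> <- <- <- a b c; rewrite map_br !map_hept /hept !br_vec. Qed.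

End PointDerivation.

Section JacobianValue.
Variable R : comNzRingType.
Variables u v w : R.

Definition wron_val (k : 'I_7) (du dv dw : R) : R :=
  let b := bra u v w in let db := dbra u v w du dv dw in
  (db k (o_ 1) (o_ 2) * b (o_ 0) (o_ 1) (o_ 3)
   + b k (o_ 1) (o_ 2) * db (o_ 0) (o_ 1) (o_ 3))
    * (b (o_ 3) (o_ 1) (o_ 2) * b (o_ 0) (o_ 1) k)
  - (b k (o_ 1) (o_ 2) * b (o_ 0) (o_ 1) (o_ 3))
    * (db (o_ 3) (o_ 1) (o_ 2) * b (o_ 0) (o_ 1) k
       + b (o_ 3) (o_ 1) (o_ 2) * db (o_ 0) (o_ 1) k).

(** The directions (Wv, -Wu, 0) and (0, -Ww, Wv) are those of [tan_u] and [tan_w]; the indices 4 and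
    5 give the image coordinates u and w. *)
Definition jac_val : R :=
  let Wu := dsurf u v w 1 0 0 in let Wv := dsurf u v w 0 1 0 in
  let Ww := dsurf u v w 0 0 1 in
  let fu := wron_val (o_ 4) in let fw := wron_val (o_ 5) in
  fu Wv (- Wu) 0 * fw 0 (- Ww) Wv - fu 0 (- Ww) Wv * fw Wv (- Wu) 0.

End JacobianValue.

Section JacobianMorphism.
Variables (R S : comNzRingType) (f : {rmorphism R -> S}).

Lemma map_dsurf u v w du dv dw :
  f (dsurf u v w du dv dw) = dsurf (f u) (f v) (f w) (f du) (f dv) (f dw).
Proof. by rewrite /dsurf !(rmorphD, rmorphN, rmorphM, rmorph1, rmorphXn). Qed.

Lemma map_dhept u v w du dv dw (c : 'I_7) :
  map_mx f (vec (dhept_coord u v w du dv dw (inr c)))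
  = vec (dhept_coord (f u) (f v) (f w) (f du) (f dv) (f dw) (inr c)).
Proof.
rewrite map_vec; congr vec.
by move: c; apply: ord7P; rewrite /= !(rmorphD, rmorphN, rmorphM, rmorph1, rmorph0).
Qed.

Lemma map_bra u v w a b c : f (bra u v w a b c) = bra (f u) (f v) (f w) a b c.
Proof. by rewrite /bra -!br_vec map_br !map_hept. Qed.

Lemma map_dbra u v w du dv dw a b c :
  f (dbra u v w du dv dw a b c) = dbra (f u) (f v) (f w) (f du) (f dv) (f dw) a b c.
Proof. by rewrite /dbra -!br_vec 2!rmorphD !map_br !map_hept !map_dhept. Qed.

Lemma map_wron_val u v w k du dv dw :
  f (wron_val u v w k du dv dw) = wron_val (f u) (f v) (f w) k (f du) (f dv) (f dw).
Proof.
have E (a b c d x y z t : R) :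
    f ((a * b + c * d) * (x * y) - (c * b) * (z * y + x * t)) =
    (f a * f b + f c * f d) * (f x * f y) - (f c * f b) * (f z * f y + f x * f t).
  by rewrite !(rmorphD, rmorphN, rmorphM).
by rewrite /wron_val E !map_bra !map_dbra.
Qed.

Lemma map_jac_val u v w : f (jac_val u v w) = jac_val (f u) (f v) (f w).
Proof.
have E (a b c d : R) : f (a * b - c * d) = f a * f b - f c * f d.
  by rewrite !(rmorphD, rmorphN, rmorphM).
rewrite /jac_val E !map_wron_val !(rmorphN f (dsurf _ _ _ _ _ _)) !map_dsurf.
by rewrite !rmorph1 !rmorph0.
Qed.

End JacobianMorphism.

Lemma jac_val_point : jac_val zu zv zw != 0.
Proof. by vm_compute. Qed.

Section SurfaceJacobian.
Variable C : numClosedFieldType.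
Let q (j : 'I_7) := hept (cU C) (cV C) (cW C) (inr j).

Definition sjac : poly3 C :=
  jacobian (sa2 C) (sa1 C) (sa0 C) (num_u q) (den_u q) (num_w q) (den_w q).

(** A derivation at a point is determined by its values on the three variables, so the Jacobian is
    computed there by forward differentiation and never expanded as a polynomial. *)
Lemma ev3_sjac u v w : ev3 u v w sjac = jac_val u v w.
Proof.
have wron d k du dv dw : derivation d ->
    ev3 u v w (d (cU C)) = du -> ev3 u v w (d (cV C)) = dv -> ev3 u v w (d (cW C)) = dw ->
    ev3 u v w (wronskian d
      (br (q k) (q (o_ 1)) (q (o_ 2))
        * br (q (o_ 0)) (q (o_ 1)) (q (o_ 3)))
      (br (q (o_ 3)) (q (o_ 1)) (q (o_ 2))
        * br (q (o_ 0)) (q (o_ 1)) (q k)))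
    = wron_val u v w k du dv dw.
  move=> [dD dM dc] <- <- <-; pose De T := ev3 u v w (d T).
  have DeD a b : De (a + b) = De a + De b by rewrite /De dD; apply: ev3D.
  have DeM a b : De (a * b) = De a * ev3 u v w b + ev3 u v w a * De b.
    by rewrite /De dM ev3D !ev3M.
  have eW f h : ev3 u v w (wronskian d f h) = De f * ev3 u v w h - ev3 u v w f * De h.
    by rewrite /wronskian ev3D ev3N !ev3M.
  have P x y z t x' y' z' t' dx dy dz dt :
      ev3 u v w x = x' -> ev3 u v w y = y' -> ev3 u v w z = z' -> ev3 u v w t = t' ->
      De x = dx -> De y = dy -> De z = dz -> De t = dt ->
      ev3 u v w (wronskian d (x * y) (z * t)) =
      (dx * y' + x' * dy) * (z' * t') - (x' * y') * (dz * t' + z' * dt).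
    by move=> <- <- <- <- <- <- <- <-; rewrite eW !DeM !ev3M.
  have eb a b c : ev3 u v w (br (q a) (q b) (q c)) = bra u v w a b c.
    exact: (@e_bra (poly3 C) C (ev3 u v w) (cU C) (cV C) (cW C) u v w
      (ev3_U u v w) (ev3_V u v w) (ev3_W u v w) a b c).
  have db a b c : De (br (q a) (q b) (q c))
      = dbra u v w (De (cU C)) (De (cV C)) (De (cW C)) a b c.
    exact: (@De_bra (poly3 C) C (ev3 u v w) De DeD DeM (cU C) (cV C) (cW C) u v w
      (ev3_U u v w) (ev3_V u v w) (ev3_W u v w) a b c).
  exact: P (eb _ _ _) (eb _ _ _) (eb _ _ _) (eb _ _ _)
    (db _ _ _) (db _ _ _) (db _ _ _) (db _ _ _).
have Ds d du dv dw : derivation d ->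
    ev3 u v w (d (cU C)) = du -> ev3 u v w (d (cV C)) = dv -> ev3 u v w (d (cW C)) = dw ->
    ev3 u v w (d (quadric (sa2 C) (sa1 C) (sa0 C))) = dsurf u v w du dv dw.
  move=> [dD dM dc] <- <- <-; rewrite quadric_surf.
  have DeD a b : ev3 u v w (d (a + b)) = ev3 u v w (d a) + ev3 u v w (d b).
    by rewrite dD; apply: ev3D.
  have DeM a b : ev3 u v w (d (a * b))
      = ev3 u v w (d a) * ev3 u v w b + ev3 u v w a * ev3 u v w (d b).
    by rewrite dM ev3D !ev3M.
  exact: (@De_surf (poly3 C) C (ev3 u v w) _ DeD DeM (cU C) (cV C) (cW C) u v w
    (ev3_U u v w) (ev3_V u v w) (ev3_W u v w)).
have det4 (a b c d : poly3 C) a' b' c' d' : ev3 u v w a = a' -> ev3 u v w b = b' ->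
    ev3 u v w c = c' -> ev3 u v w d = d' ->
    ev3 u v w (a * b - c * d) = a' * b' - c' * d'.
  by move=> <- <- <- <-; rewrite ev3D ev3N !ev3M.
have uU : ev3 u v w (d_u (cU C)) = 1 by rewrite /cU d_uE ev3_1.
have uV : ev3 u v w (d_u (cV C)) = 0 by rewrite /cV d_uE ev3_0.
have uW : ev3 u v w (d_u (cW C)) = 0 by rewrite /cW d_uE ev3_0.
have vU : ev3 u v w (d_v (cU C)) = 0 by rewrite /cU d_vE ev3_0.
have vV : ev3 u v w (d_v (cV C)) = 1 by rewrite /cV d_vE ev3_1.
have vW : ev3 u v w (d_v (cW C)) = 0 by rewrite /cW d_vE ev3_0.
have wU : ev3 u v w (d_w (cU C)) = 0 by rewrite /cU d_wE ev3_0.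
have wV : ev3 u v w (d_w (cV C)) = 0 by rewrite /cV d_wE ev3_0.
have wW : ev3 u v w (d_w (cW C)) = 1 by rewrite /cW d_wE ev3_1.
have Du := Ds _ _ _ _ (d_u_derivation C) uU uV uW.
have Dv := Ds _ _ _ _ (d_v_derivation C) vU vV vW.
have Dw := Ds _ _ _ _ (d_w_derivation C) wU wV wW.
(* The three uses of [det4] compute the field on u, v and w; products with 0 and 1 are simplified
   only at the end. *)
have wu k := wron _ k _ _ _ (tan_u_derivation (sa2 C) (sa1 C) (sa0 C))
  (det4 _ _ _ _ _ _ _ _ Dv uU Du vU) (det4 _ _ _ _ _ _ _ _ Dv uV Du vV)
  (det4 _ _ _ _ _ _ _ _ Dv uW Du vW).
have ww k := wron _ k _ _ _ (tan_w_derivation (sa2 C) (sa1 C) (sa0 C))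
  (det4 _ _ _ _ _ _ _ _ Dv wU Dw vU) (det4 _ _ _ _ _ _ _ _ Dv wV Dw vV)
  (det4 _ _ _ _ _ _ _ _ Dv wW Dw vW).
have := det4 _ _ _ _ _ _ _ _ (wu (o_ 4)) (ww (o_ 5))
  (ww (o_ 4)) (wu (o_ 5)).
rewrite !mulr1 !mulr0 !subr0 !sub0r; exact.
Qed.

Lemma sjac_point : ev3 (int_of C zu) (int_of C zv) (int_of C zw) sjac != 0.
Proof. by rewrite ev3_sjac -map_jac_val int_of_neq0 ?jac_val_point. Qed.

End SurfaceJacobian.

(** * The operator on realizations *)

Section PolynomialFunctions.
Variable C : fieldType.
Implicit Types (f : arr C -> C) (X Y Z : arr C -> 'rV[C]_3).

(** [polyfun] is an inductive predicate on functions themselves, so changing a function pointwise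
    takes extensionality. *)
Lemma pf_ext f g : f =1 g -> polyfun f -> polyfun g.
Proof. by move=> /functional_extensionality->. Qed.

Lemma pf_opp f : polyfun f -> polyfun (fun A => - f A).
Proof.
move=> pf; apply: (pf_ext _ (pf_mul (pf_cst (-1)) pf)) => A; exact: mulN1r.
Qed.

Lemma pf_sub f g : polyfun f -> polyfun g -> polyfun (fun A => f A - g A).
Proof. by move=> pf pg; apply: pf_add => //; apply: pf_opp. Qed.

Lemma pf_prod (I : Type) (r : seq I) (P : pred I) (F : I -> arr C -> C) :
  (forall i, polyfun (F i)) -> polyfun (fun A => \prod_(i <- r | P i) F i A).
Proof.
move=> pF; elim: r => [|i r IHr].
  by apply: (pf_ext _ (pf_cst 1)) => A; rewrite big_nil.
case Pi: (P i); last by apply: (pf_ext _ IHr) => A; rewrite big_cons Pi.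
by apply: (pf_ext _ (pf_mul (pF i) IHr)) => A; rewrite big_cons Pi.
Qed.

Definition polyvec X := forall j, polyfun (fun A => X A 0 j).

Lemma pf_br X Y Z : polyvec X -> polyvec Y -> polyvec Z ->
  polyfun (fun A => br (X A) (Y A) (Z A)).
Proof.
move=> pX pY pZ; rewrite /br.
by do !(first [exact: pX | exact: pY | exact: pZ
  | apply: pf_add | apply: pf_opp | apply: pf_mul]).
Qed.

Lemma polyvec_join4 X Y Z T : polyvec X -> polyvec Y -> polyvec Z -> polyvec T ->
  polyvec (fun A => join4 (X A) (Y A) (Z A) (T A)).
Proof.
move=> pX pY pZ pT j.
apply: (pf_ext (f := fun A =>
  br (X A) (Y A) (T A) * Z A 0 j - br (X A) (Y A) (Z A) * T A 0 j)).
  by move=> A; rewrite /join4 !mxE.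
by apply: pf_sub; apply: pf_mul => //; apply: pf_br.
Qed.

Lemma polyvec_coord x : polyvec (fun A => A x).
Proof. by move=> j; apply: pf_coord. Qed.

Lemma polyvec_join_line j : polyvec (fun A => join_line A j).
Proof. by apply: polyvec_join4; apply: polyvec_coord. Qed.

Lemma polyvec_next x : polyvec (fun A => next A x).
Proof. by case: x => a; [apply: polyvec_coord|apply: polyvec_join_line]. Qed.

Definition basis_triple (t : lab * lab * lab) :=
  distinct3 t.1.1 t.1.2 t.2 && ~~ nonbasis t.1.1 t.1.2 t.2.

Definition mixed (t : ('I_7 * 'I_7) * ('I_7 * 'I_7) * ('I_7 * 'I_7)) :=
  mixed6 t.1.1.1 t.1.1.2 t.1.2.1 t.1.2.2 t.2.1 t.2.2.

Definition generic_poly (A : arr C) : C :=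
  (\prod_(t : lab * lab * lab | basis_triple t)
     br (next A t.1.1) (next A t.1.2) (next A t.2)) *
  (\prod_(t : ('I_7 * 'I_7) * ('I_7 * 'I_7) * ('I_7 * 'I_7) | mixed t)
     br (join4 (A (inr t.1.1.1)) (A (inr t.1.1.2)) (A (inr t.1.2.1)) (A (inr t.1.2.2)))
        (A (inr t.2.1)) (A (inr t.2.2))).

Lemma generic_poly_polyfun : polyfun generic_poly.
Proof.
apply: pf_mul; apply: pf_prod => t; apply: pf_br; try exact: polyvec_next;
  try exact: polyvec_coord.
by apply: polyvec_join4; apply: polyvec_coord.
Qed.

Lemma generic_polyP A : reflect (generic_arr A) (generic_poly A != 0).
Proof.
rewrite mulf_eq0 negb_or; apply: (iffP andP) => [[/prodf_neq0 h1 /prodf_neq0 h2]|[h1 h2]].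
  split=> [x y z d nb|a b c d e f m].
    by apply: (h1 (x, y, z)); rewrite /basis_triple d.
  by apply: (h2 ((a, b), (c, d), (e, f))).
split; apply/prodf_neq0 => t; last by move=> m; apply: h2.
by move=> /andP[d nb]; apply: h1.
Qed.

Lemma generic_act (g : 'M[C]_3) s (A : arr C) : g \in unitmx -> (forall x, s x != 0) ->
  generic_arr A -> generic_arr (arr_act g s A).
Proof.
rewrite unitmxE unitfE => g0 s0 [h1 h2].
have nextE x : exists2 k, k != 0 & next (arr_act g s A) x = k *: (next A x *m g).
  case: x => a /=; first by exists (s (inr a)).
  by rewrite arr_act_join; eexists; last reflexivity; rewrite !mulf_neq0.
split=> [x y z d nb|a b c d e f m].
  have [kx kx0 ->] := nextE x; have [ky ky0 ->] := nextE y; have [kz kz0 ->] := nextE z.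
  by rewrite br_act !mulf_neq0 // h1.
by rewrite /arr_act join4_act br_act !mulf_neq0 // h2.
Qed.

End PolynomialFunctions.

(** * The operator on generic realizations *)

Section RealizationNext.
Variable C : fieldType.
Implicit Types A : arr C.

Lemma realization_of A :
  (forall a b c, nb_cond a b c -> br (A (inl a)) (A (inl b)) (A (inr c)) = 0) ->
  (forall x y z, distinct3 x y z -> ~~ nonbasis x y z -> br (A x) (A y) (A z) != 0) ->
  realization A.
Proof.
move=> h0 h1; apply/realizationP => x y z xy yz xz.
case nb: (nonbasis x y z); last first.
  by apply/negbTE/h1; rewrite ?nb // /distinct3 xy yz.
apply/eqP; case: x y z nb {xy yz xz} => [a|c] [b|c'] [d|d'] //= nb.
- exact: h0.
- by rewrite brC2 h0 ?oppr0.
- by rewrite brC1 brC2 h0 // !oppr0.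
Qed.

Lemma hept_realization (u v w : C) : surf u v w = 0 ->
  (forall x y z, distinct3 x y z -> ~~ nonbasis x y z ->
     br (hept u v w x) (hept u v w y) (hept u v w z) != 0) ->
  realization (hept u v w).
Proof. by move=> s0 h; apply: realization_of => //; apply: hept_nonbasis. Qed.

Lemma nb_condP (a b c : 'I_7) : nb_cond a b c ->
  [|| (a == c + 1) && (b == c - 1), (a == c + 2%:R) && (b == c - 2%:R),
      (a == c + 3%:R) && (b == c - 3%:R), (b == c + 1) && (a == c - 1),
      (b == c + 2%:R) && (a == c - 2%:R) | (b == c + 3%:R) && (a == c - 3%:R)].
Proof. by move: a b c; do 3 (apply: ord7P). Qed.

Lemma join_line_concurrent A a b c : realization A -> nb_cond a b c ->
  br (A (inr a)) (A (inr b)) (join_line A c) = 0.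
Proof.
move=> rA /nb_condP.
(* The pairs at distance 1 and 2 lie on [join_line] by construction; only this third pair uses that
   [A] is a realization. *)
have h3 : br (A (inr (c + 3%:R))) (A (inr (c - 3%:R))) (join_line A c) = 0.
  have [g [s [u [v [w [gU s0 eA s_0]]]]]] := normal_form rA.
  have -> : A = arr_act g s (hept u v w) by apply: functional_extensionality.
  by rewrite arr_act_join br_act hept_concurrent ?mulr0.
have [h1 h2] := join_line_dot A c.
by case/or4P => [||| /or3P[]] /andP[/eqP-> /eqP->] //; rewrite brC1 ?h1 ?h2 ?h3 oppr0.
Qed.

Lemma next_realization A : realization A -> generic_arr A -> realization (next A).
Proof.
move=> rA [h _]; apply: realization_of => // a b c.
exact: join_line_concurrent.
Qed.

Definition reflect7 (j i : 'I_7) : 'I_7 := j + j - i.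

Lemma sum_I7 (s : seq 'I_7) : uniq s -> size s = 7%N -> \sum_(i <- s) i = 0.
Proof.
move=> us s7; have -> : \sum_(i <- s) i = \sum_(i <- ords) i.
  apply: perm_big; apply: uniq_perm => //.
  have [] := uniq_min_size us (s2 := ords); rewrite ?s7 //.
  by move=> x _; move: x; apply: ord7P.
by rewrite /ords !big_cons big_nil; apply/val_inj.
Qed.

(** The seven labels sum to 0 modulo 7. If the three pairs have a common sum s, then 3 s + j = 0,
    that is s = 2 j. *)
Lemma matching_sum (a b c d e f j : 'I_7) : uniq [:: a; b; c; d; e; f; j] ->
  a + b = c + d -> c + d = e + f -> b = reflect7 j a /\ d = reflect7 j c.
Proof.
move=> u e1 e2; have := sum_I7 u erefl; rewrite !big_cons big_nil.
have -> : a + (b + (c + (d + (e + (f + (j + 0)))))) = (a + b) + (c + d) + (e + f) + j.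
  by rewrite addr0 !addrA.
rewrite e1 e2 => h.
have es : e + f = j + j.
  clear -h; apply/eqP; move: (e + f) j h.
  by do 2 apply: ord7P; move=> /eqP.
rewrite /reflect7 -es -e2; split; last by rewrite addrC addKr.
by rewrite -e1 addrC addKr.
Qed.

Lemma Lambda23_join A j p : realization A -> generic_arr A ->
  Lambda23 (Cprime A) (others j) p <-> on_line p (join_line A j).
Proof.
move=> rA gA; have rN := next_realization rA gA.
have [A0 _ _] := rA; have [N0 _ _] := rN.
have inS i : (i \in others j) = (i != j) by rewrite inE.
apply: (@Lambda23_line C _ (Cprime A) (others j) (reflect7 j)).
- rewrite (_ : others j = [set~ j]); last by apply/setP => i; rewrite !inE.
  by rewrite cardsC1 card_ord.
- by move=> i _; apply: A0.
- by move=> a b c _ _ _ u; apply: (realization_br_neq0 rA).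
- move=> i; rewrite !inS; move: i j {inS}; do 2 apply: ord7P; done.
- move=> i; rewrite !inS; move: i j {inS}; do 2 apply: ord7P; done.
- by move=> i; rewrite /reflect7 opprB addrCA subrr addr0.
- exact: (N0 (inr j)).
- move=> i; rewrite inS => ij; rewrite on_lineE -br_cross /Cprime.
  rewrite join_line_concurrent //; move: i j ij {inS}; do 2 apply: ord7P; done.
(* Collinear meets cannot come from a mixed sextuple, so the pair sums agree; the six labels
   together with [j] are all seven, as [matching_sum] requires. *)
move=> a b c d e f nj u b0.
have [_ h] := gA; have h' := h a b c d e f.
have /andP[/eqP e1 /eqP e2] : (a + b == c + d) && (c + d == e + f).
  apply: contraT => ns; have := h'; rewrite /mixed6 u ns => /(_ isT).
  by rewrite -/(Cprime A a) b0 eqxx.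
apply: (@matching_sum a b c d e f) e1 e2.
rewrite -[[:: a; b; c; d; e; f; j]]/(rcons [:: a; b; c; d; e; f] j) rcons_uniq u andbT.
move: nj; rewrite /= !inS !inE !negb_or !(eq_sym j) andbT.
by case/and5P => -> -> -> -> /andP[-> ->].
Qed.

End RealizationNext.

(** * Density of the generic locus and dominance on the moduli space *)

Section Main.
Variable C : numClosedFieldType.
Implicit Types (A : arr C) (Q : arr C -> C).

(** A polynomial function can be applied to arrangements with polynomial entries; on the universal
    normal form it yields a single polynomial in (u, v, w). *)
Lemma pf_lift Q : polyfun Q -> exists Qr : (lab -> 'rV[poly3 C]_3) -> poly3 C,
  forall u v w B, ev3 u v w (Qr B) = Q (fun x => map_mx (ev3 u v w) (B x)).
Proof.
elim=> [c|x j|f g _ [F hF] _ [G hG]|f g _ [F hF] _ [G hG]].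
- by exists (fun _ => cst3 c) => u v w B; rewrite /cst3 ev3C ev2_cst.
- by exists (fun B => B x 0 j) => u v w B; rewrite mxE.
- by exists (fun B => F B + G B) => u v w B; rewrite ev3D hF hG.
- by exists (fun B => F B * G B) => u v w B; rewrite ev3M hF hG.
Qed.

Definition hept3 : lab -> 'rV[poly3 C]_3 := hept (cU C) (cV C) (cW C).

Lemma ev3_hept u v w x : map_mx (ev3 u v w) (hept3 x) = hept u v w x.
Proof.
have E (K : comNzRingType) (f : {rmorphism K -> C}) a b c a' b' c' :
    f a = a' -> f b = b' -> f c = c' -> map_mx f (hept a b c x) = hept a' b' c' x.
  by move=> <- <- <-; apply: map_hept.
exact: (E (poly3 C) (ev3 u v w) _ _ _ _ _ _ (ev3_U u v w) (ev3_V u v w) (ev3_W u v w)).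
Qed.

Lemma ev3_hept_br u v w x y z : ev3 u v w (br (hept3 x) (hept3 y) (hept3 z)) =
  br (hept u v w x) (hept u v w y) (hept u v w z).
Proof.
have E (K : comNzRingType) (f : {rmorphism K -> C}) a b c a' b' c' :
    map_mx f a = a' -> map_mx f b = b' -> map_mx f c = c' -> f (br a b c) = br a' b' c'.
  by move=> <- <- <-; apply: map_br.
exact: (E (poly3 C) (ev3 u v w) _ _ _ _ _ _
  (ev3_hept u v w x) (ev3_hept u v w y) (ev3_hept u v w z)).
Qed.

Lemma pf_lift_act Q g s : polyfun Q -> exists T : poly3 C,
  forall u v w, ev3 u v w T = Q (arr_act g s (hept u v w)).
Proof.
move=> /pf_lift[Qr hQ].
exists (Qr (fun x => cst3 (s x) *: (hept3 x *m map_mx (@cst3 C) g))) => u v w.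
rewrite hQ; congr Q; apply: functional_extensionality => x.
rewrite map_mxZ map_mxM ev3_hept /arr_act -map_mx_comp /=.
have -> : ev3 u v w (cst3 (s x)) = s x by rewrite /cst3 ev3C ev2_cst.
congr (_ *: (_ *m _)); apply/matrixP => i j; rewrite mxE /=.
by rewrite /cst3 ev3C ev2_cst.
Qed.

Lemma ev3_quadric u v w : ev3 u v w (quadric (sa2 C) (sa1 C) (sa0 C)) = surf u v w.
Proof.
have E (K : comNzRingType) (f : {rmorphism K -> C}) x y z a b c :
    f x = a -> f y = b -> f z = c -> f (surf x y z) = surf a b c.
  by move=> <- <- <-; apply: map_surf.
rewrite quadric_surf.
exact: (E (poly3 C) (ev3 u v w) _ _ _ _ _ _ (ev3_U u v w) (ev3_V u v w) (ev3_W u v w)).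
Qed.

(** [N] multiplies all the open conditions: the bases of M_7, the genericity of the operator and the
    Jacobian. Each factor is nonzero at the integral point. *)
Lemma exists_generic_locus : exists N : poly3 C,
  ev3 (int_of C zu) (int_of C zv) (int_of C zw) N != 0 /\
  forall u v w, surf u v w = 0 -> ev3 u v w N != 0 ->
    [/\ realization (hept u v w), generic_arr (hept u v w) & ev3 u v w (sjac C) != 0].
Proof.
have [T hT] := pf_lift_act 1%:M (fun _ => 1) (generic_poly_polyfun C).
have {}hT u v w : ev3 u v w T = generic_poly (hept u v w).
  rewrite hT; congr generic_poly; apply: functional_extensionality => x.
  by rewrite /arr_act mulmx1 scale1r.
pose B := \prod_(t : lab * lab * lab | basis_triple t)
  br (hept3 t.1.1) (hept3 t.1.2) (hept3 t.2).
have hB u v w : ev3 u v w B =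
    \prod_(t : lab * lab * lab | basis_triple t)
       br (hept u v w t.1.1) (hept u v w t.1.2) (hept u v w t.2).
  rewrite /B (rmorph_prod (ev3 u v w)); apply: eq_bigr => t _.
  exact: ev3_hept_br.
exists (T * B * sjac C); split=> [|u v w s0].
  rewrite !ev3M !mulf_neq0 ?sjac_point //.
    by rewrite hT; apply/generic_polyP/generic_point.
  by rewrite hB; apply/prodf_neq0 => t /andP[d nb]; apply: basis_point.
rewrite !ev3M !mulf_eq0 !negb_or hT hB.
move=> /andP[/andP[/generic_polyP gA /prodf_neq0 b0] J0].
split => //; apply: hept_realization => // x y z d nb.
by apply: (b0 (x, y, z)); rewrite /basis_triple d.
Qed.

(** w and w - 1 are, up to sign, brackets of basis triples; so every realization lies where the
    equation is quadratic in v. *)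
Lemma realization_sa2 u v w : realization (hept u v w) -> ev2 u w (sa2 C) != 0.
Proof.
move=> rA; have w0 : w != 0.
  have := realization_br_neq0 (x := p_ 1) (y := p_ 2) (z := p_ 5) rA isT isT.
  by apply: contra_neq => w0; rewrite /hept !br_vec /brt /= w0; ring.
have w1 : w - 1 != 0.
  have := realization_br_neq0 (x := p_ 1) (y := p_ 3) (z := p_ 5) rA isT isT.
  by apply: contra_neq => w1; rewrite /hept !br_vec /brt /= -[RHS]w1; ring.
by rewrite /sa2 /pW ev2N ev2M ev2D ev2N ev2_w ev2_1 oppr_eq0 mulf_neq0.
Qed.

Lemma normal_form_eq A : realization A -> exists g s u v w,
  [/\ g \in unitmx, forall x, s x != 0, A = arr_act g s (hept u v w), surf u v w = 0
    & realization (hept u v w)].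
Proof.
move=> rA; have [g [s [u [v [w [gU s0 eA e]]]]]] := normal_form rA.
have {}eA : A = arr_act g s (hept u v w) by apply: functional_extensionality.
exists g, s, u, v, w; split => //; apply: arr_act_realizationE gU s0 _.
by rewrite -eA.
Qed.

Lemma surf_z0 : surf (int_of C zu) (int_of C zv) (int_of C zw) = 0.
Proof. by rewrite -map_surf surf_point rmorph0. Qed.

(** With [g] and [s] fixed by the given realization, [Q] becomes a polynomial on the surface, and
    the generic points of that one family suffice. *)
Lemma generic_dense : dense_open_in_U (@generic_poly C).
Proof.
move=> Q pQ hQ A rA.
have [g [s [u [v [w [gU s0 -> sz rz]]]]]] := normal_form_eq rA.
have [N [N0 hN]] := exists_generic_locus.
have [T hT] := pf_lift_act g s pQ; rewrite -hT.
have q0 := surf_z0; rewrite -ev3_quadric in q0.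
have [r0 _ _] := hN _ _ _ surf_z0 N0.
apply: (vanish_everywhere (sa2_neq0 C) (sa_disc C) (sE0 C) q0 (realization_sa2 r0) N0).
- move=> u' v' w'; rewrite ev3_quadric => s' /(hN _ _ _ s')[r' g' _].
  rewrite hT; apply: hQ; first exact: arr_act_realization.
  by apply/generic_polyP/generic_act.
- by rewrite ev3_quadric.
- exact: realization_sa2 rz.
Qed.

(** Numerator and denominator involve the same vectors with the same multiplicities, so the scalars
    and the determinant cancel and the quotients can be read off the normal form. *)
Lemma next_coordinates (g : 'M[C]_3) s (A : arr C) u v w :
  g \in unitmx -> (forall x, s x != 0) ->
  (forall k, A (inr k) = arr_act g s (hept u v w) (inl k)) ->
  let q k := A (inr k) in
  den_u q != 0 -> den_w q != 0 ->
  u = num_u q / den_u q /\ w = num_w q / den_w q.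
Proof.
rewrite unitmxE unitfE => g0 s0 e q; rewrite /den_u /den_w /num_u /num_w /q !e.
rewrite /arr_act !br_act /hept !br_vec /brt /= => _ _.
by split; field; rewrite !s0 g0.
Qed.

Lemma next_dominant Q : polyfun Q ->
  (forall A, realization A -> generic_poly A != 0 ->
     forall (g : 'M[C]_3) (s : lab -> C), g \in unitmx -> (forall x, s x != 0) ->
     Q (arr_act g s (next A)) = 0) ->
  forall A, realization A -> Q A = 0.
Proof.
move=> pQ hQ A rA.
have [g [s [u [v [w [gU s0 -> sz rz]]]]]] := normal_form_eq rA.
have [N [N0 hN]] := exists_generic_locus.
have [T hT] := pf_lift_act g s pQ; rewrite -hT.
have q0 := surf_z0; rewrite -ev3_quadric in q0.
have [r0 _ _] := hN _ _ _ surf_z0 N0.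
pose q k := hept3 (inr k).
have evq u' v' w' a b c : ev3 u' v' w' (br (q a) (q b) (q c))
    = br (hept u' v' w' (inr a)) (hept u' v' w' (inr b)) (hept u' v' w' (inr c)).
  exact: ev3_hept_br.
have evprod u' v' w' (x y : poly3 C) a b : ev3 u' v' w' x = a -> ev3 u' v' w' y = b ->
    ev3 u' v' w' (x * y) = a * b by move=> <- <-; apply: ev3M.
have enu u' v' w' : ev3 u' v' w' (num_u q) = num_u (fun k => hept u' v' w' (inr k)).
  by apply: evprod; apply: evq.
have edu u' v' w' : ev3 u' v' w' (den_u q) = den_u (fun k => hept u' v' w' (inr k)).
  by apply: evprod; apply: evq.
have enw u' v' w' : ev3 u' v' w' (num_w q) = num_w (fun k => hept u' v' w' (inr k)).
  by apply: evprod; apply: evq.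
have edw u' v' w' : ev3 u' v' w' (den_w q) = den_w (fun k => hept u' v' w' (inr k)).
  by apply: evprod; apply: evq.
have den0 (u' v' w' : C) : generic_arr (hept u' v' w') ->
    den_u (fun k => hept u' v' w' (inr k)) != 0 /\
    den_w (fun k => hept u' v' w' (inr k)) != 0.
  move=> [h _]; split; apply: mulf_neq0.
  - exact: (h (p_ 3) (p_ 1) (p_ 2)).
  - exact: (h (p_ 0) (p_ 1) (p_ 4)).
  - exact: (h (p_ 3) (p_ 1) (p_ 2)).
  - exact: (h (p_ 0) (p_ 1) (p_ 5)).
apply: (dominant (sa2_neq0 C) (sa_disc C) (sE0 C) q0 (realization_sa2 r0) N0
  (f1 := num_u q) (h1 := den_u q) (f2 := num_w q) (h2 := den_w q)).
- move=> u' v' w'; rewrite ev3_quadric => s' /(hN _ _ _ s')[r' g' J'].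
  have [d1 d2] := den0 _ _ _ g'.
  by split; [exact: realization_sa2 r'|rewrite edu|rewrite edw|exact: J'].
- move=> u' v' w'; rewrite ev3_quadric => s' /(hN _ _ _ s')[r' g' _].
  have rN := next_realization r' g'.
  have [g1 [s1 [u1 [v1 [w1 [g1U s10 e1 sz1 _]]]]]] := normal_form_eq rN.
  have [d1 d2] := den0 _ _ _ g'.
  have [eu ew] := next_coordinates g1U s10 (fun k => congr1 (@^~ (inl k)) e1) d1 d2.
  have at_image a b : a = u1 -> b = w1 ->
      exists v', ev3 a v' b (quadric (sa2 C) (sa1 C) (sa0 C)) = 0 /\ ev3 a v' b T = 0.
    move=> -> ->; exists v1; rewrite ev3_quadric; split => //.
    (* The hypothesis covers the whole orbit of [next], so the image, normalized by [g1] and [s1],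
       can be moved into the frame [g], [s] in which [T] was defined. *)
    rewrite hT -(_ : arr_act (invmx g1 *m g) (fun x => s x * (s1 x)^-1)
        (next (hept u' v' w'))
        = arr_act g s (hept u1 v1 w1)).
      apply: hQ => //; first exact/generic_polyP.
        by rewrite unitmx_mul unitmx_inv g1U.
      by move=> x; rewrite mulf_neq0 ?invr_eq0.
    apply: functional_extensionality => x; rewrite -arr_act_comp e1.
    rewrite {1}/arr_act [in RHS]/arr_act; congr (_ *: (_ *m _)).
    by rewrite /arr_act -scalemxAl -mulmxA mulmxV // mulmx1 scalerA mulVf ?scale1r.
  have quot a b a' b' : a = a' -> b = b' -> a / b = a' / b' :> C by move=> -> ->.
  apply: at_image.
    exact: etrans (quot _ _ _ _ (enu _ _ _) (edu _ _ _)) (esym eu).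
  exact: etrans (quot _ _ _ _ (enw _ _ _) (edw _ _ _)) (esym ew).
- by rewrite ev3_quadric.
- exact: realization_sa2 rz.
Qed.

End Main.

Theorem theorem3p2 (R : realType) :
  exists P : arr R[i] -> R[i],
    polyfun P /\ dense_open_in_U P /\
    exists G : 'I_7 -> 'I_3 -> arr R[i] -> R[i],
      (forall j c, polyfun (G j c)) /\
      (forall A : arr R[i], realization A -> P A != 0 ->
         let m := fun j => \row_(c < 3) G j c A in
         (forall j : 'I_7, m j != 0 /\
            forall p : 'rV[R[i]]_3, p != 0 ->
              (Lambda23 (Cprime A) (others j) p <-> on_line p (m j)))
         /\ realization (next_arr A m)) /\
      (forall Q, polyfun Q ->
         (forall A : arr R[i], realization A -> P A != 0 ->
            forall (g : 'M[R[i]]_3) (s : lab -> R[i]),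
              g \in unitmx -> (forall x, s x != 0) ->
              Q (arr_act g s (next_arr A (fun j => \row_(c < 3) G j c A))) = 0) ->
         forall A, realization A -> Q A = 0).
Proof.
exists (@generic_poly R[i]); split; first exact: generic_poly_polyfun.
split; first exact: generic_dense.
exists (fun j c A => join_line A j 0 c); split.
  by move=> j c; apply: polyvec_join_line.
have rowE (A : arr R[i]) :
    (fun j => \row_(c < 3) join_line A j 0 c) = (fun j => join_line A j).
  by apply: functional_extensionality => j; apply/rowP => c; rewrite mxE.
have nextE (A : arr R[i]) : next_arr A (fun j => join_line A j) = next A.
  by apply: functional_extensionality; case.
split=> [A rA /generic_polyP gA m|Q pQ hQ].
  have {m} -> : m = (fun j => join_line A j) by apply: rowE.
  have rN := next_realization rA gA; have [N0 _ _] := rN.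
  rewrite nextE; split => // j; split => [|p _]; first exact: (N0 (inr j)).
  exact: Lambda23_join.
apply: (next_dominant pQ) => A rA gA g s gU s0.
by rewrite -nextE -rowE; apply: hQ.
Qed.
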